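(* Let $k\in\{3,4\}$, let $\Delta t>0$ be arbitrary and $n\ge k-1$. For the RAV/BDF-$k$ scheme described in the context, the following discrete energy law holds (unconditional energy stability): $$\alpha_k\left(E[\phi^{n+1}]+r^{n+1}\right)-A_k\left(E[\phi^{n}]+r^n\right)\leq 0.$$
   Context: Let $\Omega\subset\mathbb{R}^d$ ($d=2,3$) be the domain, $\epsilon>0$, and $F:\mathbb{R}\to\mathbb{R}$ a (smooth) energy density function. The free energy is $$E[\phi]=\int_\Omega\left(\frac{\epsilon^2}{2}|\nabla\phi|^2+F(\phi)\right)d\bm{x}.$$ It is assumed to be bounded from below, and $C_0$ is a constant with $\tilde E[\phi]:=E[\phi]+C_0>0$ for all $\phi$. The gradient flow approximated is $\partial_t\phi=\Delta\mu$, $\mu=-\epsilon^2\Delta\phi+F'(\phi)$, with either periodic boundary conditions or $\frac{\partial\phi}{\partial\bm{n}}|_{\partial\Omega}=\frac{\partial\mu}{\partial\bm{n}}|_{\partial\Omega}=0$. The time-discrete functions satisfy the same boundary conditions and are regular enough for all expressions to make sense. RAV/BDF-$k$ scheme (time step $\Delta t>0$, stabilization parameter $\lambda>0$). Given the previous $k$ values of $\phi$, $\overline{\phi}$ and $r$ (at indices $n,n-1,\dots,n-k+1$), the functions $\phi^{n+1},\mu^{n+1},\overline{\phi}^{n+1}$ and the real number $r^{n+1}$ satisfy $$\frac{\alpha_k\phi^{n+1}-A_k(\phi^{n})}{\Delta t}=\Delta \mu^{n+1},$$ $$\mu^{n+1}=-\epsilon^2\Delta \phi^{n+1}+\lambda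 \phi^{n+1}+F'(B_k(\overline{\phi}^n))-\lambda B_k(\overline{\phi}^n),$$ $$r^{n+1}=0\text{ if }U_k^{n+1}\ge0,\qquad r^{n+1}=U_k^{n+1}\text{ if }U_k^{n+1}<0,$$ $$\overline{\phi}^{n+1}=\xi^{n+1}\phi^{n+1},\qquad \xi^{n+1}=\frac{\tilde{E}[\phi^{n+1}]+r^{n+1}}{\tilde{E}[\phi^{n+1}]}.$$ For $k=3$: $\alpha_3=\frac{11}{6}$, $A_3(\phi^n)=3\phi^n-\frac{3}{2}\phi^{n-1}+\frac{1}{3}\phi^{n-2}$, $B_3(\overline{\phi}^n)=3\overline{\phi}^n-3\overline{\phi}^{n-1}+\overline{\phi}^{n-2}$, and $$U_3^{n+1}=\frac{18r^n-9r^{n-1}+2r^{n-2}}{11}+\int_\Omega \mu^{n+1}\,\frac{11\phi^{n+1}-18\phi^{n}+9\phi^{n-1}-2\phi^{n-2}}{11}\, d\bm{x}$$ $$\qquad-\frac{11E[\phi^{n+1}]-18E[\phi^{n}]+9E[\phi^{n-1}]-2E[\phi^{n-2}]}{11}+\frac{6}{11}\Delta t\Vert \nabla\mu^{n+1}\Vert_{L^2}^2.$$ For $k=4$: $\alpha_4=\frac{25}{12}$, $A_4(\phi^n)=4\phi^n-3\phi^{n-1}+\frac{4}{3}\phi^{n-2}-\frac{1}{4}\phi^{n-3}$, $B_4(\overline{\phi}^n)=4\overline{\phi}^n-6\overline{\phi}^{n-1}+4\overline{\phi}^{n-2}-\overline{\phi}^{n-3}$, and $$U_4^{n+1}=\frac{48r^n-36r^{n-1}+16r^{n-2}-3r^{n-3}}{25}+\int_\Omega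 \mu^{n+1}\,\frac{25\phi^{n+1}-48\phi^{n}+36\phi^{n-1}-16\phi^{n-2}+3\phi^{n-3}}{25}\, d\bm{x}$$ $$\qquad-\frac{25E[\phi^{n+1}]-48E[\phi^{n}]+36E[\phi^{n-1}]-16E[\phi^{n-2}]+3E[\phi^{n-3}]}{25}+\frac{12}{25}\Delta t\Vert \nabla\mu^{n+1}\Vert_{L^2}^2.$$ The operators $A_k$ act on any sequence by the same linear combination; e.g. $A_3(E[\phi^n]+r^n)=3(E[\phi^n]+r^n)-\frac32(E[\phi^{n-1}]+r^{n-1})+\frac13(E[\phi^{n-2}]+r^{n-2})$, and analogously for $A_4$. *)

(* Defs.v *)
From HB Require Import structures.
From mathcomp Require Import all_boot all_order all_algebra.
From mathcomp Require Import all_classical all_reals all_analysis.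

Set Implicit Arguments.
Unset Strict Implicit.
Unset Printing Implicit Defensive.
Import Order.TTheory GRing.Theory Num.Theory.
Import numFieldNormedType.Exports.
Local Open Scope classical_set_scope.
Local Open Scope ring_scope.

Definition measure_rV_display : measure_display.
Proof. exact: default_measure_display. Qed.

(* Borel sigma-algebra of 'rV[R]_d, generated by the coordinate maps. *)
Section measurable_rV.
Context {R : realType} {d : nat}.

Let coors : 'I_d -> 'rV[R]_d -> measurableTypeR R := fun i x => x ord0 i.

Let rV_set0 : g_sigma_preimage coors set0.
Proof. exact: sigma_algebra0. Qed.

Let rV_setC A : g_sigma_preimage coors A -> g_sigma_preimage coors (~` A).
Proof. exact: sigma_algebraC. Qed.

Let rV_bigcup (F : _^nat) : (forall i, g_sigma_preimage coors (F i)) ->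
  g_sigma_preimage coors (\bigcup_i (F i)).
Proof. exact: sigma_algebra_bigcup. Qed.

HB.instance Definition _ := @isMeasurable.Build measure_rV_display
  'rV[R]_d (g_sigma_preimage coors) rV_set0 rV_setC rV_bigcup.

Lemma measurable_coord_rV (i : 'I_d) :
  measurable_fun [set: 'rV[R]_d] (fun x => x ord0 i : measurableTypeR R).
Proof.
move=> _ Y mY; rewrite setTI; apply: sub_sigma_algebra => /=.
rewrite -bigcup_seq/=; exists i => /=; first by rewrite mem_index_enum.
by exists Y => //; rewrite setTI.
Qed.

Lemma measurable_fun_rV d0 (T : measurableType d0) (f : T -> 'rV[R]_d) :
  (forall i, measurable_fun setT (fun t => f t ord0 i : measurableTypeR R)) ->
  measurable_fun setT f.
Proof.
move=> mf _ A mA; rewrite setTI.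
have: g_sigma_preimage (fun i => coors i \o f) `<=` @measurable _ T.
  apply: smallest_sub; first exact: sigma_algebra_measurable.
  move=> B; rewrite -bigcup_seq => -[i _] [C mC <-].
  exact: mf.
apply; rewrite (@g_sigma_preimage_comp _ (measurableTypeR R) d 'rV[R]_d coors _ f).
by exists A => //; rewrite setTI.
Qed.

End measurable_rV.

Section lebesgue_measure_rV.
Context {R : realType}.

Definition cons_rV {d} (p : measurableTypeR R * 'rV[R]_d) : 'rV[R]_d.+1 :=
  row_mx p.1%:M p.2.

Definition uncons_rV {d} (x : 'rV[R]_d.+1) : measurableTypeR R * 'rV[R]_d :=
  (x ord0 ord0, \row_(i < d) x ord0 (lift ord0 i)).

Lemma cons_rVK {d} : cancel (@cons_rV d) uncons_rV.
Proof.
move=> [t x]; congr (_, _).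
  rewrite /cons_rV /= (_ : ord0 = lshift d (ord0 : 'I_1)); last exact/val_inj.
  by rewrite [LHS](row_mxEl (t%:M : 'rV_1)) mxE eqxx mulr1n.
apply/rowP => i; rewrite mxE /cons_rV /=.
rewrite (_ : lift ord0 i = rshift 1 i); last exact/val_inj.
by rewrite [LHS](row_mxEr (t%:M : 'rV_1)).
Qed.

Lemma measurable_cons_rV {d} : measurable_fun setT (@cons_rV d).
Proof.
apply: measurable_fun_rV => i; case: (unliftP ord0 i) => [j|] ->.
  rewrite (_ : (fun t => _) = (fun x : 'rV_d => x ord0 j : measurableTypeR R) \o snd).
    by apply: measurableT_comp; [exact: measurable_coord_rV|].
  apply/funext => p /=; have := cons_rVK p => /(congr1 snd)/rowP/(_ j).
  by rewrite mxE.
rewrite (_ : (fun t => _) = fst) //.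
by apply/funext => p; have := cons_rVK p => /(congr1 fst).
Qed.

Lemma measurable_uncons_rV {d} : measurable_fun setT (@uncons_rV d).
Proof.
apply/measurable_fun_pair; first exact: measurable_coord_rV.
apply: measurable_fun_rV => i.
under eq_fun do rewrite mxE.
exact: measurable_coord_rV.
Qed.

Definition lebesgue_rV_succ d (m : {sigma_finite_measure set 'rV[R]_d -> \bar R}) :
    set 'rV[R]_d.+1 -> \bar R :=
  pushforward (@lebesgue_measure R \x m)%E cons_rV.

Section lebesgue_rV_succ.
Variables (d : nat) (m : {sigma_finite_measure set 'rV[R]_d -> \bar R}).

Let mcons := @measurable_cons_rV d.

HB.instance Definition _ := Measure.copy (lebesgue_rV_succ m)
  (measure_function_pushforward__canonical__measure_function_Measure _ mcons).

Let sigma_finite_succ : sigma_finite setT (lebesgue_rV_succ m).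
Proof.
have /sigma_finiteP[F [TF ndF Foo]] := sigma_finiteT (@lebesgue_measure R).
have /sigma_finiteP[G [TG ndG Goo]] := sigma_finiteT m.
exists (fun k => uncons_rV @^-1` (F k `*` G k)).
  apply/seteqP; split=> // x _.
  have : [set: measurableTypeR R] (uncons_rV x).1 by [].
  have : [set: 'rV[R]_d] (uncons_rV x).2 by [].
  rewrite TF TG => -[i _ Gi] [j _ Fj]; exists (maxn i j) => //; split.
  - by move: (uncons_rV x).1 Fj; exact/subsetPset/ndF/leq_maxr.
  - by move: (uncons_rV x).2 Gi; exact/subsetPset/ndG/leq_maxl.
move=> k; have [mF Fk] := Foo k; have [mG Gk] := Goo k; split.
  rewrite -[X in measurable X]setTI.
  by apply: measurable_uncons_rV => //; exact: measurableX.
rewrite /lebesgue_rV_succ /pushforward -comp_preimage.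
rewrite (_ : _ @^-1` _ = F k `*` G k); last first.
  apply/funext => p.
  by rewrite -[LHS]/((F k `*` G k) (uncons_rV (cons_rV p))) cons_rVK.
by rewrite product_measure1E// lte_mul_pinfty// ge0_fin_numE.
Qed.

HB.instance Definition _ :=
  @Measure_isSigmaFinite.Build _ _ _ (lebesgue_rV_succ m) sigma_finite_succ.

End lebesgue_rV_succ.

(* d-fold product of lebesgue_measure, transported to 'rV[R]_d. *)
Fixpoint lebesgue_rV d : {sigma_finite_measure set 'rV[R]_d -> \bar R} :=
  match d return {sigma_finite_measure set 'rV[R]_d -> \bar R} with
  | 0%N => \d_(0 : 'rV[R]_0)
  | d'.+1 => lebesgue_rV_succ (lebesgue_rV d')
  end.

End lebesgue_measure_rV.

Section calculus.
Context {R : realType} {d : nat}.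
Implicit Types (U Omega : set 'rV[R]_d) (f : 'rV[R]_d -> R) (x y : 'rV[R]_d).

Definition base (i : 'I_d) : 'rV[R]_d := delta_mx 0 i.

Definition dotr x y : R := \sum_(i < d) x 0 i * y 0 i.

(* The library norm `|x| on 'rV[R]_d is the sup norm. *)
Definition enorm x : R := Num.sqrt (dotr x x).

Definition grad f x : 'rV[R]_d := \row_(i < d) 'D_(base i) f x.

Definition laplacian f x : R := \sum_(i < d) 'D_(base i) ('D_(base i) f) x.

(* Meant for open U. *)
Fixpoint class_C k U f : Prop :=
  (forall x, U x -> {for x, continuous f}) /\
  match k with
  | 0%N => True
  | k'.+1 => forall i, (forall x, U x -> derivable f x (base i)) /\
                       class_C k' U ('D_(base i) f)
  end.

Definition smooth (F : R -> R) : Prop := forall k t, derivable (derive1n k F) t 1.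

Definition boundary Omega : set 'rV[R]_d := closure Omega `\` Omega°.

(* Near the boundary point x, Omega is the sublevel set {rho < 0} of a C^1
   function with nonvanishing gradient; nu is then the exterior unit normal. *)
Definition outward_normal Omega x (nu : 'rV[R]_d) : Prop :=
  boundary Omega x /\
  exists U (rho : 'rV[R]_d -> R),
    [/\ open U, U x, class_C 1 U rho, grad rho x != 0 &
        Omega `&` U = [set y | rho y < 0] `&` U] /\
    nu = (enorm (grad rho x))^-1 *: grad rho x.

Definition singular_boundary Omega : set 'rV[R]_d :=
  [set x | boundary Omega x /\ ~ exists nu, outward_normal Omega x nu].

(* Zero (d-1)-dimensional Hausdorff measure. The library balls are open cubes,
   which does not change the null sets. *)
Definition hypersurface_null (S : set 'rV[R]_d) : Prop :=
  forall e : R, 0 < e ->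
    exists (c : nat -> 'rV[R]_d) (r : nat -> R),
      [/\ forall k, 0 < r k, S `<=` \bigcup_k ball (c k) (r k) &
          (\sum_(0 <= k <oo) ((r k) ^+ d.-1)%:E < e%:E)%E].

Variant boundary_condition :=
| Periodic of 'rV[R]_d & 'rV[R]_d
| Neumann.

(* Periodic case: the open box with opposite corners a and b.
   Neumann case: a bounded domain whose boundary is of class C^1 up to an
   H^(d-1)-null set, which includes smooth domains, boxes and polyhedra. *)
Definition is_domain (bc : boundary_condition) Omega : Prop :=
  match bc with
  | Periodic a b =>
      (forall i, a 0 i < b 0 i) /\
      Omega = [set x | forall i, a 0 i < x 0 i < b 0 i]
  | Neumann =>
      [/\ open Omega, connected Omega, Omega !=set0, bounded_set Omega &
          hypersurface_null (singular_boundary Omega)]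
  end.

(* Functions of class C^2 up to the boundary that satisfy the boundary
   condition. Periodic functions are identified with their periodic extension
   to the whole space, which has to be C^2. *)
Definition admissible (bc : boundary_condition) Omega f : Prop :=
  match bc with
  | Periodic a b =>
      class_C 2 setT f /\
      forall x i, f (x + (b 0 i - a 0 i) *: base i) = f x
  | Neumann =>
      (exists U, [/\ open U, closure Omega `<=` U & class_C 2 U f]) /\
      forall x nu, outward_normal Omega x nu -> dotr (grad f x) nu = 0
  end.

End calculus.

Arguments boundary_condition : clear implicits.

Section scheme.
Context {R : realType} {d : nat}.
Variables (bc : boundary_condition R d) (Omega : set 'rV[R]_d).
Variables (eps : R) (F : R -> R) (C0 : R).
Local Notation leb := (lebesgue_rV d).

Definition energy (f : 'rV[R]_d -> R) : R :=
  \int[leb]_(x in Omega)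
    (eps ^+ 2 / 2 * dotr (grad f x) (grad f x) + F (f x)).

Definition shifted_energy (f : 'rV[R]_d -> R) : R := energy f + C0.

(* The BDF coefficients; only k = 3 and k = 4 are meaningful. *)
Definition bdf_alpha (k : nat) : R :=
  match k with 3 => 11 / 6 | 4 => 25 / 12 | _ => 0 end.

Definition bdf_A (k : nat) (u : nat -> R) (n : nat) : R :=
  match k with
  | 3 => 3 * u n - 3 / 2 * u (n - 1)%N + 1 / 3 * u (n - 2)%N
  | 4 => 4 * u n - 3 * u (n - 1)%N + 4 / 3 * u (n - 2)%N
         - 1 / 4 * u (n - 3)%N
  | _ => 0
  end.

Definition bdf_B (k : nat) (u : nat -> R) (n : nat) : R :=
  match k with
  | 3 => 3 * u n - 3 * u (n - 1)%N + u (n - 2)%N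
  | 4 => 4 * u n - 6 * u (n - 1)%N + 4 * u (n - 2)%N - u (n - 3)%N
  | _ => 0
  end.

Section step.
Variables (dt lambda : R).
Variables (phi mu phibar : nat -> 'rV[R]_d -> R) (r : nat -> R).

(* rav_U k n is $U_k^{n+1}$. *)
Definition rav_U (k n : nat) : R :=
  match k with
  | 3 =>
      (18 * r n - 9 * r (n - 1)%N + 2 * r (n - 2)%N) / 11
      + \int[leb]_(x in Omega)
          (mu n.+1 x * ((11 * phi n.+1 x - 18 * phi n x + 9 * phi (n - 1)%N x
                         - 2 * phi (n - 2)%N x) / 11))
      - (11 * energy (phi n.+1) - 18 * energy (phi n)
         + 9 * energy (phi (n - 1)%N) - 2 * energy (phi (n - 2)%N)) / 11
      + 6 / 11 * dt * \int[leb]_(x in Omega)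
          dotr (grad (mu n.+1) x) (grad (mu n.+1) x)
  | 4 =>
      (48 * r n - 36 * r (n - 1)%N + 16 * r (n - 2)%N - 3 * r (n - 3)%N) / 25
      + \int[leb]_(x in Omega)
          (mu n.+1 x * ((25 * phi n.+1 x - 48 * phi n x + 36 * phi (n - 1)%N x
                         - 16 * phi (n - 2)%N x + 3 * phi (n - 3)%N x) / 25))
      - (25 * energy (phi n.+1) - 48 * energy (phi n)
         + 36 * energy (phi (n - 1)%N) - 16 * energy (phi (n - 2)%N)
         + 3 * energy (phi (n - 3)%N)) / 25
      + 12 / 25 * dt * \int[leb]_(x in Omega)
          dotr (grad (mu n.+1) x) (grad (mu n.+1) x)
  | _ => 0
  end.

Definition xi (n : nat) : R :=
  (shifted_energy (phi n) + r n) / shifted_energy (phi n).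

(* One step, from the data at indices n - k + 1, ..., n to index n + 1. *)
Record RAV_BDF_step (k n : nat) : Prop := {
  step_phi_admissible : forall m, (n.+1 - k <= m <= n.+1)%N ->
    admissible bc Omega (phi m);
  step_phibar_admissible : forall m, (n.+1 - k <= m <= n.+1)%N ->
    admissible bc Omega (phibar m);
  step_mu_admissible : admissible bc Omega (mu n.+1);
  step_phi : forall x, Omega x ->
    (bdf_alpha k * phi n.+1 x - bdf_A k (fun m => phi m x) n) / dt
    = laplacian (mu n.+1) x;
  step_mu : forall x, Omega x ->
    mu n.+1 x = - eps ^+ 2 * laplacian (phi n.+1) x + lambda * phi n.+1 x
      + derive1 F (bdf_B k (fun m => phibar m x) n)
      - lambda * bdf_B k (fun m => phibar m x) n;
  step_r : r n.+1 = if 0 <= rav_U k n then 0 else rav_U k n;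
  step_phibar : forall x, Omega x -> phibar n.+1 x = xi n.+1 * phi n.+1 x
}.

End step.
End scheme.

(* Main.v *)
Require Import Defs.
From mathcomp Require Import all_boot all_order all_algebra.
From mathcomp Require Import all_classical all_reals all_analysis.
From mathcomp Require Import measurable_realfun.
From mathcomp Require Import ring lra.
Import Order.TTheory GRing.Theory Num.Theory.
Import numFieldNormedType.Exports.
Local Open Scope classical_set_scope.
Local Open Scope ring_scope.

(** The number r^(n+1) is the minimum of 0 and U^(n+1), so r^(n+1) <= U^(n+1). When
    this inequality is multiplied by alpha_k, the energies and the previous values
    of r in U^(n+1) cancel against the energy law, whose left-hand side is therefore
    at most
      int mu (alpha_k phi^(n+1) - A_k phi^n) + dt int |grad mu|^2,
    where mu = mu^(n+1). By the first equation of the scheme this is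
    dt (int mu Lap mu + int |grad mu|^2), and it remains to prove Green's identity
    [green_identity] for mu, that is, that the integral over Omega of the divergence
    of the field W = mu grad mu is 0.

    On a box with periodic data this is Fubini's theorem and the fundamental theorem
    of calculus, [integral_derive_box].

    In the Neumann case W is tangent to the boundary wherever the latter is of class
    C^1, and [divergence_tangential] shows that this is enough. No surface measure
    is involved: let T(phi) be the integral over Omega of div (phi W), called
    [int_div]; the aim is T(1) = 0.
    - If phi is supported near a point of Omega, T(phi) = 0 by the case of a box
      ([flux_interior]).
    - If phi is supported near a regular boundary point, where Omega is {rho < 0},
      multiply phi by a C^1 approximation h_m(rho) of the indicator function of
      {rho < 0}. The case of a box leaves the integral of
      phi (W . grad rho) h_m'(rho), which tends to 0: W . grad rho vanishes on
      {rho = 0}, hence is small in the layer that carries h_m'(rho), and the integral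
      of |h_m'(rho)| is bounded independently of m ([flux_regular]).
    - The singular part of the boundary is covered by cubes of radii r_k with the sum
      of r_k^(d-1) less than e. Cutoffs that remove these cubes have gradients of
      order 1/r_k on volumes of order r_k^d, so they change T by O(e)
      ([flux_cubes]).
    Compactness of the closure of Omega lets one combine finitely many cutoffs of
    these kinds ([flux1_le]), and |T(1)| <= C e for every e in ]0, 1]. *)

Set Implicit Arguments.
Unset Strict Implicit.
Unset Printing Implicit Defensive.

(** * Boxes, cubes and their volume *)

Section boxes.
Context {R : realType} {d : nat}.
Implicit Types (a b x y : 'rV[R]_d) (A D : set 'rV[R]_d).

Definition box a b : set 'rV[R]_d := [set x | forall i, a 0 i < x 0 i < b 0 i].

Definition cbox a b : set 'rV[R]_d :=
  [set x | forall i, a 0 i <= x 0 i <= b 0 i].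

Lemma box_cbox a b : box a b `<=` cbox a b.
Proof. by move=> x xab i; have /andP[/ltW-> /ltW->] := xab i. Qed.

Definition lo x e : 'rV[R]_d := x - const_mx e.
Definition hi x e : 'rV[R]_d := x + const_mx e.

Lemma ball_cube x e : 0 < e -> ball x e = box (lo x e) (hi x e).
Proof.
move=> e0; apply/seteqP; split=> [y [_ xy] i|y xy].
  by have := xy 0 i; rewrite /ball/= !mxE ltr_distlC.
split=> // i j; rewrite (ord1 i); have := xy j; rewrite !mxE /ball/= ltr_distlC.
by [].
Qed.

Lemma measurable_box a b : measurable (box a b).
Proof.
rewrite (_ : box a b = \bigcap_(i in [set: 'I_d])
    ((fun x : 'rV[R]_d => x ord0 i : measurableTypeR R) @^-1`
       `]a 0 i, b 0 i[)); last first.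
  apply/seteqP; split=> [x xab i _|x xab i] /=.
    by rewrite in_itv/=; exact: xab.
  by have := xab i I; rewrite /= in_itv.
apply: fin_bigcap_measurable => // i _.
rewrite -[X in measurable X]setTI.
by apply: measurable_coord_rV => //; exact: measurable_itv.
Qed.

(** The sigma-algebra on row vectors is generated by the coordinates, hence
    contains boxes; cubes with rational centre and radius are a countable base. *)
Lemma open_measurable_rV D : open D -> measurable D.
Proof.
move=> oD.
pose c (q : 'rV[rat]_d * rat) : set 'rV[R]_d := 
    ball (map_mx (@ratr R) q.1 : 'rV[R]_d) (ratr q.2).
rewrite (_ : D = \bigcup_q (if `[< c q `<=` D >] then c q else set0)).
  apply: countable_bigcupT_measurable => // q.
  case: ifPn => // _; rewrite /c.
  have [q0|q0] := ltP 0 (ratr q.2 : R).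
    by rewrite ball_cube//; exact: measurable_box.
  rewrite (_ : ball _ _ = set0)//; apply/seteqP; split=> // y [].
  by rewrite ltNge q0.
apply/seteqP; split=> [x Dx|x [q _]]; last first.
  by case: ifPn => // /asboolP; exact.
have /nbhs_ballP[e /= e0 eD] : nbhs x D by exact: open_nbhs_nbhs.
have [r] : exists r : rat, ratr r \in `]0, (e / 2) : R[.
  by apply: rat_in_itvoo; rewrite divr_gt0.
rewrite in_itv/= => /andP[r0 re].
have /choice[q qP] : forall i, exists s : rat,
    `|ratr s - x 0 i| < ratr r :> R.
  move=> i; have [s] : exists s : rat,
      ratr s \in `](x 0 i - ratr r), (x 0 i + ratr r) : R[.
    by apply: rat_in_itvoo; rewrite ltrD2l gt0_cp.
  by rewrite in_itv/= -ltr_distl; exists s.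
have xq : c (\row_i q i, r) x.
  by split=> //= i j; rewrite !mxE (ord1 i); exact: qP.
exists (\row_i q i, r) => //; rewrite ifT//; apply/asboolP => y qy.
apply: eD; rewrite (splitr e); apply: (@le_ball _ _ _ (ratr r + ratr r)).
  by apply: lerD; exact: ltW.
by apply: ball_triangle qy; exact: ball_sym.
Qed.

Lemma continuous_measurable_rV D (f : 'rV[R]_d -> R) : open D ->
  (forall x, D x -> {for x, continuous f}) ->
  measurable_fun D (f : 'rV[R]_d -> measurableTypeR R).
Proof.
move=> oD cf; apply: (measurability _ (RGenOpens.measurableE R)).
move=> _ [_ [a [b ->] <-]]; apply: open_measurable_rV.
rewrite openE => x [Dx fx]; rewrite /interior.
apply: filterI; first exact: open_nbhs_nbhs.
by apply: (cf _ Dx); apply: open_nbhs_nbhs; split => //; exact: interval_open.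
Qed.

Lemma compact_cbox a b : compact (cbox a b).
Proof.
have := @rV_compact R d (fun i => `[a 0 i, b 0 i]%classic)
  (fun i => @segment_compact R _ _).
have -> : [set v : 'rV[R]_d | forall i, `[a 0 i, b 0 i]%classic (v ord0 i)] = cbox a b.
  apply/seteqP; split=> x xab i; have := xab i; rewrite /= in_itv /=; exact.
exact.
Qed.

End boxes.

Section volume.
Context {R : realType}.

Lemma cons_rV0 d (p : R * 'rV[R]_d) : cons_rV p 0 ord0 = p.1.
Proof. by have /(congr1 fst) := cons_rVK p. Qed.

Lemma cons_rVS d (p : R * 'rV[R]_d) i : cons_rV p 0 (lift ord0 i) = p.2 0 i.
Proof. by have /(congr1 snd)/rowP/(_ i) := cons_rVK p; rewrite mxE. Qed.

Definition tail_rV d (a : 'rV[R]_d.+1) : 'rV[R]_d := \row_i a 0 (lift ord0 i).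

Lemma box_cons d (a b : 'rV[R]_d.+1) p :
  box a b (cons_rV p) <->
  a 0 ord0 < p.1 < b 0 ord0 /\ box (tail_rV a) (tail_rV b) p.2.
Proof.
split=> [h|[h1 h2] i].
  split; first by have := h ord0; rewrite cons_rV0.
  by move=> i; rewrite !mxE; have := h (lift ord0 i); rewrite cons_rVS.
case: (unliftP ord0 i) => [j|] ->; last by rewrite cons_rV0.
by rewrite cons_rVS; have := h2 j; rewrite !mxE.
Qed.

Lemma cbox_cons d (a b : 'rV[R]_d.+1) p :
  cbox a b (cons_rV p) <->
  a 0 ord0 <= p.1 <= b 0 ord0 /\ cbox (tail_rV a) (tail_rV b) p.2.
Proof.
split=> [h|[h1 h2] i].
  split; first by have := h ord0; rewrite cons_rV0.
  by move=> i; rewrite !mxE; have := h (lift ord0 i); rewrite cons_rVS.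
case: (unliftP ord0 i) => [j|] ->; last by rewrite cons_rV0.
by rewrite cons_rVS; have := h2 j; rewrite !mxE.
Qed.

(** The measure is an iterated product, so the volume is computed one coordinate
    at a time. *)
Lemma lebesgue_box d (a b : 'rV[R]_d) : (forall i, a 0 i <= b 0 i) ->
  lebesgue_rV d (box a b) = (\prod_i (b 0 i - a 0 i))%:E.
Proof.
elim: d a b => [|d IH] a b ab.
  rewrite big_ord0 /= diracE mem_set// => -[].
  by [].
rewrite big_ord_recl /= /lebesgue_rV_succ /pushforward.
rewrite (_ : _ @^-1` _ = `]a 0 ord0, b 0 ord0[%classic `*`
                         box (tail_rV a) (tail_rV b)); last first.
  by apply/seteqP; split=> p /=; rewrite in_itv/= => /box_cons.
rewrite product_measure1E//; last exact: measurable_box.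
rewrite IH; last by move=> i; rewrite !mxE.
rewrite /= lebesgue_measure_itv/= lte_fin; case: ifPn => [_|].
  rewrite -EFinB -EFinM; congr EFin; congr *%R.
  by apply: eq_bigr => i _; rewrite !mxE.
rewrite -leNgt => ba; rewrite mul0e (_ : b 0 ord0 = a 0 ord0) ?subrr ?mul0r//.
by apply/eqP; rewrite eq_le ba ab.
Qed.

End volume.

(** * The integral of a partial derivative over a box *)

Section fubini.
Context {R : realType} {d : nat}.

Let mcons := @measurable_cons_rV R d.

Lemma integrable_cons_rV (f : 'rV[R]_d.+1 -> \bar R) :
  (lebesgue_rV d.+1).-integrable setT f ->
  (@lebesgue_measure R \x lebesgue_rV d)%E.-integrable setT (f \o cons_rV).
Proof.
move=> /integrableP[mf foo]; apply/integrableP; split.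
  exact: measurableT_comp mf mcons.
move: foo; rewrite [X in (X < _)%E](_ : _ =
  (\int[@lebesgue_measure R \x lebesgue_rV d]_(x in cons_rV @^-1` setT)
     ((abse \o f) \o cons_rV) x)%E)//.
apply: (@ge0_integral_pushforward _ _ _ _ _ _ mcons) => //.
by apply: measurableT_comp.
Qed.

Lemma integral_rV_cons (f : 'rV[R]_d.+1 -> \bar R) :
  (lebesgue_rV d.+1).-integrable setT f ->
  (\int[lebesgue_rV d.+1]_x f x =
   \int[@lebesgue_measure R]_t \int[lebesgue_rV d]_y f (cons_rV (t, y)))%E.
Proof.
move=> intf; have [mf _] := integrableP _ _ _ intf.
have intf' := integrable_cons_rV intf.
rewrite [LHS](_ : _ =
  (\int[@lebesgue_measure R \x lebesgue_rV d]_x (f \o cons_rV) x)%E).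
  by rewrite -integral12_prod_meas1.
exact: (@integral_pushforward _ _ _ _ _ _ mcons).
Qed.

Lemma integral_rV_consC (f : 'rV[R]_d.+1 -> \bar R) :
  (lebesgue_rV d.+1).-integrable setT f ->
  (\int[lebesgue_rV d.+1]_x f x =
   \int[lebesgue_rV d]_y \int[@lebesgue_measure R]_t f (cons_rV (t, y)))%E.
Proof.
move=> intf; have [mf _] := integrableP _ _ _ intf.
rewrite integral_rV_cons//.
exact: (@Fubini _ _ _ _ _ _ _ (f \o cons_rV) (integrable_cons_rV intf)).
Qed.

End fubini.

Section box_integral.
Context {R : realType}.

Lemma open_slice d (U : set 'rV[R]_d.+1) t : open U ->
  open [set y : 'rV[R]_d | U (cons_rV (t, y))].
Proof.
rewrite !openE => oU y /oU; rewrite /interior => /nbhs_ballP[e /= e0 eU].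
apply/nbhs_ballP; exists e => //= z [_ yz]; apply: eU; split=> // i j.
rewrite (ord1 i); case: (unliftP ord0 j) => [k|] ->.
  by rewrite !cons_rVS.
by rewrite !cons_rV0/=; exact: ballxx.
Qed.

Lemma continuous_cons_rV d t : continuous (fun y : 'rV[R]_d => cons_rV (t, y)).
Proof.
move=> y A /nbhs_ballP[e /= e0 eA]; apply/nbhs_ballP.
exists e => //= z [_ yz]; apply: eA; split=> // i j.
rewrite (ord1 i); case: (unliftP ord0 j) => [k|] ->.
  by rewrite !cons_rVS.
by rewrite !cons_rV0/=; exact: ballxx.
Qed.

Lemma continuous_cons_rVl d (y : 'rV[R]_d) :
  continuous (fun t : R => cons_rV (t, y)).
Proof.
move=> t A /nbhs_ballP[e /= e0 eA]; apply/nbhs_ballP.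
exists e => //= s ts; apply: eA; split=> // i j.
rewrite (ord1 i); case: (unliftP ord0 j) => [k|] ->.
  by rewrite !cons_rVS/=; exact: ballxx.
by rewrite !cons_rV0/=.
Qed.

Lemma cons_rV_line d (t : R) (y : 'rV[R]_d) (h : R) i :
  h *: base (lift ord0 i) + cons_rV (t, y) = cons_rV (t, h *: base i + y).
Proof.
apply/rowP => j; rewrite [LHS]mxE; case: (unliftP ord0 j) => [k|] ->.
  by rewrite !cons_rVS/= !mxE (inj_eq lift_inj).
by rewrite !cons_rV0/= !mxE mulr0 add0r.
Qed.

Lemma cons_rV_line0 d (t : R) (y : 'rV[R]_d) (h : R) :
  h *: base ord0 + cons_rV (t, y) = cons_rV (h + t, y).
Proof.
apply/rowP => j; rewrite [LHS]mxE; case: (unliftP ord0 j) => [k|] ->.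
  by rewrite !cons_rVS/= !mxE mulr0 add0r.
by rewrite !cons_rV0/= !mxE mulr1.
Qed.

Lemma derive_slice d (g : 'rV[R]_d.+1 -> R) t y i :
  'D_(base i) (fun y => g (cons_rV (t, y))) y =
  'D_(base (lift ord0 i)) g (cons_rV (t, y)).
Proof.
rewrite /derive; set g1 := fun h => h^-1 *: _; set g2 := fun h => h^-1 *: _.
suff -> : g1 = g2 by [].
by apply/funext => h; rewrite /g1 /g2 /= cons_rV_line.
Qed.

Lemma derivable_slice d (g : 'rV[R]_d.+1 -> R) t y i :
  derivable g (cons_rV (t, y)) (base (lift ord0 i)) ->
  derivable (fun y => g (cons_rV (t, y))) y (base i).
Proof.
rewrite /derivable; set g1 := fun h => h^-1 *: _; set g2 := fun h => h^-1 *: _.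
suff -> : g2 = g1 by [].
by apply/funext => h; rewrite /g1 /g2 /= cons_rV_line.
Qed.

Lemma derive_slice0 d (g : 'rV[R]_d.+1 -> R) t y :
  'D_1 (fun t => g (cons_rV (t, y))) t = 'D_(base ord0) g (cons_rV (t, y)).
Proof.
rewrite /derive; set g1 := fun h => h^-1 *: _; set g2 := fun h => h^-1 *: _.
suff -> : g1 = g2 by [].
by apply/funext => h; rewrite /g1 /g2 /= cons_rV_line0 /= [_%:A]mulr1.
Qed.

Lemma derivable_slice0 d (g : 'rV[R]_d.+1 -> R) t y :
  derivable g (cons_rV (t, y)) (base ord0) ->
  derivable (fun t => g (cons_rV (t, y))) t 1.
Proof.
rewrite /derivable; set g1 := fun h => h^-1 *: _; set g2 := fun h => h^-1 *: _.
suff -> : g2 = g1 by [].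
by apply/funext => h; rewrite /g1 /g2 /= cons_rV_line0 [_%:A]mulr1.
Qed.

Lemma continuous_compact_bounded (T : topologicalType) (K : set T)
    (f : T -> R) : compact K -> (forall x, K x -> {for x, continuous f}) ->
  exists2 M, 0 <= M & forall x, K x -> `|f x| <= M.
Proof.
move=> cK cf; have /compact_bounded[M [_ fM]] : compact (f @` K).
  apply: continuous_compact cK.
  by apply: continuous_in_subspaceT => x; rewrite inE; exact: cf.
exists (`|M| + 1) => // x Kx; apply: fM; last by exists x.
by rewrite (le_lt_trans (ler_norm M))// ltrDl.
Qed.

Lemma open_box d (a b : 'rV[R]_d) : open (box a b).
Proof.
rewrite openE => x xab.
apply: (@filter_forall _ _ (fun i => [set y : 'rV[R]_d | a 0 i < y 0 i < b 0 i])
  (nbhs x)) => i; have /andP[ax xb] := xab i.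
have cx : (y : 'rV[R]_d) 0 i @[y --> x] --> x 0 i by exact: coord_continuous.
near=> y; apply/andP; split; near: y.
- by apply: (cvgr_gt _ cx).
- by apply: (cvgr_lt _ cx).
Unshelve. all: by end_near. Qed.

Lemma finite_box d (a b : 'rV[R]_d) : (lebesgue_rV d (box a b) < +oo)%E.
Proof.
have [ab|] := pselect (forall i, a 0 i <= b 0 i).
  by rewrite lebesgue_box// ltry.
move=> ab; rewrite (_ : box a b = set0) ?measure0//.
apply/seteqP; split=> // x xab; apply: ab => i.
by have /andP[h1 h2] := xab i; rewrite ltW// (lt_trans h1).
Qed.

Lemma continuous_box_integrable d (a b : 'rV[R]_d) (f : 'rV[R]_d -> R) :
  (forall x, cbox a b x -> {for x, continuous f}) ->
  (lebesgue_rV d).-integrable (box a b) (EFin \o f).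
Proof.
move=> cf; apply: measurable_bounded_integrable.
- exact: measurable_box.
- exact: finite_box.
- apply: continuous_measurable_rV; last by move=> x /box_cbox; exact: cf.
  exact: open_box.
- have [M _ fM] := continuous_compact_bounded (@compact_cbox _ _ a b) cf.
  exists M; split; first exact: num_real.
  by move=> N MN x /box_cbox xab; exact: le_trans (fM _ xab) (ltW MN).
Qed.

(** Fubini reduces the integral to lines parallel to the i-th axis, where the
    fundamental theorem of calculus leaves the difference of the values of [g] on
    two opposite faces. Asking for equal values there covers both functions that
    vanish near the faces and periodic functions. *)
Lemma integral_derive_box d (a b : 'rV[R]_d) U (g : 'rV[R]_d -> R) i :
  (forall j, a 0 j < b 0 j) -> open U -> cbox a b `<=` U ->
  (forall x, U x -> {for x, continuous g}) ->
  (forall x, U x -> derivable g x (base i)) ->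
  (forall x, U x -> {for x, continuous ('D_(base i) g)}) ->
  (forall x, cbox a b x -> x 0 i = a 0 i ->
    g (x + (b 0 i - a 0 i) *: base i) = g x) ->
  (\int[lebesgue_rV d]_(x in box a b) ('D_(base i) g x)%:E = 0)%E.
Proof.
elim: d a b U g i => [a b U g []//|d IH] a b U g i ab oU abU cg dg cDg face.
have intg : (lebesgue_rV d.+1).-integrable setT
    ((EFin \o 'D_(base i) g) \_ (box a b)).
  apply/(integrable_mkcond _ (measurable_box a b)).
  by apply: continuous_box_integrable => x /abU; exact: cDg.
rewrite integral_mkcond.
case: (unliftP ord0 i) dg cDg face intg => [j|] -> dg cDg face intg.
  (* The direction of derivation is among the last coordinates: freeze the first
     one, t, and use the induction hypothesis on the slice. *)
  rewrite integral_rV_cons//; apply: integral0_eq => t _.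
  have [abt|abt] := pselect (a 0 ord0 < t < b 0 ord0); last first.
    apply: integral0_eq => y _; rewrite patchE memNset//.
    by move=> /box_cons[].
  rewrite [LHS](_ : _ = (\int[lebesgue_rV d]_(y in box (tail_rV a) (tail_rV b))
      ('D_(base j) (fun y => g (cons_rV (t, y))) y)%:E)%E).
    have cbt y : cbox (tail_rV a) (tail_rV b) y -> cbox a b (cons_rV (t, y)).
      by move=> aby; apply/cbox_cons; split=> //=; move/andP: abt => [/ltW-> /ltW->].
    apply: (IH _ _ [set y | U (cons_rV (t, y))]).
    - by move=> k; rewrite !mxE.
    - exact: open_slice.
    - by move=> y /cbt/abU.
    - move=> y Uy; apply: (@continuous_comp _ _ _ (fun y => cons_rV (t, y)) g).
        exact: continuous_cons_rV.
      exact: cg.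
    - by move=> y Uy; apply: derivable_slice; exact: dg.
    - move=> y Uy; rewrite (_ : 'D_(base j) _ =
        'D_(base (lift ord0 j)) g \o (fun y => cons_rV (t, y))).
        apply: continuous_comp; first exact: continuous_cons_rV.
        exact: cDg.
      by apply/funext => z; rewrite derive_slice.
    - move=> y aby yj; have := face _ (cbt _ aby).
      rewrite cons_rVS/= yj mxE => /(_ erefl) <-.
      congr g; rewrite [RHS]addrC cons_rV_line [in RHS]addrC.
      by congr (cons_rV (t, _ + _ *: _)); rewrite !mxE.
  rewrite [RHS]integral_mkcond; apply: eq_integral => y _.
  rewrite !patchE; case: ifPn => [/set_mem/box_cons[_ aby]|/negP aby].
    by rewrite mem_set//= derive_slice.
  rewrite memNset// => aby'; apply: aby; apply/mem_set/box_cons.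
  by split.
(* Derivation along the first coordinate: integrate in that direction first. *)
rewrite integral_rV_consC//; apply: integral0_eq => y _.
have [aby|aby] := pselect (box (tail_rV a) (tail_rV b) y); last first.
  apply: integral0_eq => t _; rewrite patchE memNset//.
  by move=> /box_cons[].
pose G t := g (cons_rV (t, y)).
have Uab t : t \in `[a 0 ord0, b 0 ord0] -> U (cons_rV (t, y)).
  move=> tab; apply: abU; apply/cbox_cons; split; last exact: box_cbox.
  by move: tab; rewrite in_itv.
have cG t : t \in `[a 0 ord0, b 0 ord0] -> {for t, continuous G}.
  move=> /Uab Ut; apply: (@continuous_comp _ _ _ (fun t => cons_rV (t, y)) g).
    exact: continuous_cons_rVl.
  exact: cg.
have cDG t : t \in `[a 0 ord0, b 0 ord0] -> {for t, continuous ('D_1 G)}.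
  move=> /Uab Ut; rewrite (_ : 'D_1 G =
    'D_(base ord0) g \o (fun t => cons_rV (t, y))).
    apply: continuous_comp; first exact: continuous_cons_rVl.
    exact: cDg.
  by apply/funext => s; rewrite derive_slice0.
have wDG : {within `[a 0 ord0, b 0 ord0], continuous ('D_1 G)}.
  by apply: continuous_in_subspaceT => t; rewrite inE; exact: cDG.
pose a0 := a 0 ord0; pose b0 := b 0 ord0.
transitivity (\int[@lebesgue_measure R]_(t in `]a0, b0[)
    ('D_1 G t)%:E)%E.
  rewrite [RHS]integral_mkcond; apply: eq_integral => t _.
  rewrite !patchE; case: ifPn => [/set_mem/box_cons[abt _]|/negP abt].
    by rewrite mem_set/= ?in_itv//= /G derive_slice0.
  rewrite memNset//= => abt'; apply: abt; apply/mem_set/box_cons.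
  by split=> //; rewrite in_itv in abt'.
rewrite -(@integral_itv_bndoo _ _ _ _ true false); last first.
  apply/measurable_EFinP; apply: open_continuous_measurable_fun => //.
  move=> t /set_mem tab; apply: cDG; exact: subset_itv_oo_cc tab.
rewrite (@continuous_FTC2 _ ('D_1 G) G _ _ (ab ord0) wDG).
- apply/eqP; rewrite sube_eq// add0e; apply/eqP; congr EFin.
  rewrite /G.
  have ay : cbox a b (cons_rV (a 0 ord0, y)).
    by apply/cbox_cons; split; [rewrite /= lexx ltW|exact: box_cbox].
  rewrite -[RHS]face//; last by rewrite cons_rV0.
  by rewrite [in RHS]addrC cons_rV_line0 subrK.
- split.
  + move=> t tab; apply: derivable_slice0; apply: dg; apply: Uab.
    exact: subset_itv_oo_cc tab.
  + apply: cvg_at_right_filter; apply: cG.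
    by rewrite in_itv/= lexx ltW.
  + apply: cvg_at_left_filter; apply: cG.
    by rewrite in_itv/= lexx ltW.
- by move=> t tab; rewrite derive1E.
Qed.

End box_integral.

(** * Continuously differentiable functions *)

(** A directional derivative is the derivative along a line, which reduces this
    chain rule to the one-variable case. *)
Lemma is_derive_comp_line (R : realType) (V : normedModType R) (h : R -> R) (f : V -> R) x v
    dh df :
  is_derive x v f df -> is_derive (f x) 1 h dh ->
  is_derive x v (fun y => h (f y)) (dh * df).
Proof.
move=> [/derivable1P fx fdf] [hx hdh].
pose l (s : R) := f (s *: v + x).
have l0 : l 0 = f x by rewrite /l scale0r add0r.
have dl : derive1 l 0 = df.
  rewrite derive1E -fdf /derive /l; set g1 := fun h => h^-1 *: _.
  set g2 := fun h => h^-1 *: _; suff -> : g1 = g2 by [].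
  by apply/funext => s; rewrite /g1 /g2 /= scale0r add0r addr0 [_%:A]mulr1.
have hl : derivable h (l 0) 1 by rewrite l0.
have dl0 : differentiable l 0 by exact/derivable1_diffP.
have dh0 : differentiable h (l 0) by apply/derivable1_diffP.
have dhl : derivable (h \o l) 0 1.
  by apply/derivable1_diffP; exact: differentiable_comp.
have Ehl : 'D_1 (h \o l) 0 = dh * df.
  by rewrite -derive1E (@derive1_comp R l h 0 fx hl) dl derive1E l0 hdh.
apply: DeriveDef; first by apply/derivable1P.
rewrite -Ehl /derive /l.
set g1 := fun h => h^-1 *: _.
set g2 := fun h => h^-1 *: _; suff -> : g1 = g2 by [].
by apply/funext => s; rewrite /g1 /g2 /= scale0r add0r addr0 [_%:A]mulr1.
Qed.

Section C1_functions.
Context {R : realType} {d : nat}.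
Implicit Types (U V : set 'rV[R]_d) (f g : 'rV[R]_d -> R) (x : 'rV[R]_d).

Definition C1 U f : Prop :=
  [/\ forall x, U x -> {for x, continuous f},
      forall i x, U x -> derivable f x (base i) &
      forall i x, U x -> {for x, continuous ('D_(base i) f)}].

Lemma class_C1 k U f : class_C k.+1 U f -> C1 U f.
Proof.
move=> [cf df]; split=> // i x Ux; have [dfi cdf] := df i; first exact: dfi.
by case: k cdf {df} => [|k] [c _]; exact: c.
Qed.

Lemma class_C2 U f i : class_C 2 U f -> C1 U ('D_(base i) f).
Proof. by move=> [_ df]; have [_] := df i; exact: (@class_C1 0). Qed.

Lemma C1S U V f : V `<=` U -> C1 U f -> C1 V f.
Proof. by move=> VU [cf df cdf]; split=> [x|i x|i x] /VU; [apply: cf|apply: df|apply: cdf]. Qed.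

Lemma C1_cst U (c : R) : C1 U (fun=> c).
Proof.
split=> [x _|i x _|i x _]; [exact: cst_continuous|exact: derivable_cst|].
rewrite (_ : 'D_(base i) _ = cst 0); first exact: cst_continuous.
by apply/funext => y; exact: derive_cst.
Qed.

Lemma eq_nbhs_continuous U f g x : open U -> U x ->
  (forall y, U y -> f y = g y) -> {for x, continuous f} ->
  {for x, continuous g}.
Proof.
move=> oU Ux fg cf; rewrite /prop_for /continuous_at -fg//.
apply: (@cvg_trans _ (f y @[y --> x])); last exact: cf.
have fgx : {near nbhs x, f =1 g}.
  have Unx : nbhs x U by exact: open_nbhs_nbhs.
  exact: filterS fg Unx.
exact: near_eq_cvg fgx.
Qed.

Lemma C1_derive_eq U f (df : 'I_d -> 'rV[R]_d -> R) : open U ->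
  (forall x, U x -> {for x, continuous f}) ->
  (forall i x, U x -> is_derive x (base i) f (df i x)) ->
  (forall i x, U x -> {for x, continuous (df i)}) -> C1 U f.
Proof.
move=> oU cf Df cdf; split=> // i x Ux; first by have [] := Df i x Ux.
apply: (eq_nbhs_continuous oU Ux) (cdf _ _ Ux) => y Uy.
by have [_ ->] := Df i y Uy.
Qed.

Lemma is_derive_C1 U f i x : C1 U f -> U x ->
  is_derive x (base i) f ('D_(base i) f x).
Proof. by move=> [_ df _] Ux; apply: DeriveDef => //; exact: df. Qed.

Lemma deriveM_C1 U f g i x : C1 U f -> C1 U g -> U x ->
  'D_(base i) (fun y => f y * g y) x =
  'D_(base i) f x * g x + f x * 'D_(base i) g x.
Proof.
move=> [_ df _] [_ dg _] Ux.
by rewrite (deriveM (df i x Ux) (dg i x Ux)) addrC /GRing.scale/= [g x * _]mulrC.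
Qed.

Lemma C1M U f g : open U -> C1 U f -> C1 U g -> C1 U (fun x => f x * g x).
Proof.
move=> oU Cf Cg; have [cf df cdf] := Cf; have [cg dg cdg] := Cg.
apply: (@C1_derive_eq _ _
  (fun i x => 'D_(base i) f x * g x + f x * 'D_(base i) g x)) => //.
- by move=> x Ux; exact: cvgM (cf _ Ux) (cg _ Ux).
- move=> i x Ux; rewrite -(deriveM_C1 _ Cf Cg)//.
  by apply: DeriveDef => //; apply: derivableM; [exact: df|exact: dg].
- move=> i x Ux.
  exact: cvgD (cvgM (cdf i _ Ux) (cg _ Ux)) (cvgM (cf _ Ux) (cdg i _ Ux)).
Qed.

Lemma deriveB_C1 U f g i x : C1 U f -> C1 U g -> U x ->
  'D_(base i) (fun y => f y - g y) x = 'D_(base i) f x - 'D_(base i) g x.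
Proof.
by move=> [_ df _] [_ dg _] Ux; rewrite (deriveB (df i x Ux) (dg i x Ux)).
Qed.

Lemma C1B U f g : open U -> C1 U f -> C1 U g -> C1 U (fun x => f x - g x).
Proof.
move=> oU Cf Cg; have [cf df cdf] := Cf; have [cg dg cdg] := Cg.
apply: (@C1_derive_eq _ _
  (fun i x => 'D_(base i) f x - 'D_(base i) g x)) => //.
- by move=> x Ux; exact: cvgB (cf _ Ux) (cg _ Ux).
- move=> i x Ux; rewrite -(deriveB_C1 _ Cf Cg)//.
  by apply: DeriveDef => //; apply: derivableB; [exact: df|exact: dg].
- by move=> i x Ux; exact: cvgB (cdf i _ Ux) (cdg i _ Ux).
Qed.

Lemma derive_comp_C1 U (h dh : R -> R) f i x :
  (forall t : R, is_derive t (1 : R) h (dh t)) -> C1 U f -> U x ->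
  'D_(base i) (fun y => h (f y)) x = dh (f x) * 'D_(base i) f x.
Proof.
move=> Dh Cf Ux.
by have [_ ->] := is_derive_comp_line (is_derive_C1 i Cf Ux) (Dh (f x)).
Qed.

Lemma C1_comp U (h dh : R -> R) f :
  (forall t : R, is_derive t (1 : R) h (dh t)) -> continuous dh ->
  open U -> C1 U f -> C1 U (fun x => h (f x)).
Proof.
move=> Dh cdh oU Cf; have [cf df cdf] := Cf.
have ch : continuous h.
  move=> t; apply: differentiable_continuous; apply/derivable1_diffP.
  by have [] := Dh t.
apply: (@C1_derive_eq _ _ (fun i x => dh (f x) * 'D_(base i) f x)) => //.
- by move=> x Ux; apply: (@continuous_comp _ _ _ f h); [exact: cf|exact: ch].
- move=> i x Ux; exact: is_derive_comp_line (is_derive_C1 i Cf Ux) (Dh (f x)).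
- move=> i x Ux; apply: (cvgM _ (cdf i _ Ux)).
  by apply: (@continuous_comp _ _ _ f dh); [exact: cf|exact: cdh].
Qed.

Lemma is_derive_coord (j i : 'I_d) x :
  is_derive x (base i) (fun y : 'rV[R]_d => y 0 j) (i == j)%:R.
Proof.
have E : (fun h : R => h^-1 *: ((h *: base i + x) 0 j - x 0 j)) @ 0^'
    --> ((i == j)%:R : R).
  apply: (@cvg_trans _ (((fun=> (i == j)%:R) : R -> R) @ 0^')); last exact: cvg_cst.
  apply: near_eq_cvg; near=> h.
  rewrite !mxE addrK eqxx/= [h^-1 *: _]mulKf ?[j == i]eq_sym//.
  by near: h; exact: nbhs_dnbhs_neq.
split; first by apply/cvg_ex; exists (i == j)%:R.
exact: cvg_lim E.
Unshelve. all: by end_near. Qed.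

Lemma C1_coord U j : open U -> C1 U (fun x => x 0 j).
Proof.
move=> oU; apply: (@C1_derive_eq _ _ (fun i x => (i == j)%:R)) => //.
- by move=> x _; exact: coord_continuous.
- by move=> i x _; exact: is_derive_coord.
- by move=> i x _; exact: cst_continuous.
Qed.

Lemma C1_prod (I : Type) (s : seq I) (f : I -> 'rV[R]_d -> R) :
  (forall k, C1 setT (f k)) -> C1 setT (fun x => \prod_(k <- s) f k x).
Proof.
move=> Cf; elim: s => [|k s IH].
  by under eq_fun do rewrite big_nil; exact: C1_cst.
under eq_fun do rewrite big_cons.
by apply: C1M => //; exact: openT.
Qed.

(** A product of numbers in [0, 1] is 1-Lipschitz in each factor. *)
Lemma derive_prod_le (I : Type) (s : seq I) (f : I -> 'rV[R]_d -> R) i x :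
  (forall k, C1 setT (f k)) -> (forall k, 0 <= f k x <= 1) ->
  `|'D_(base i) (fun x => \prod_(k <- s) f k x) x| <=
    \sum_(k <- s) `|'D_(base i) (f k) x|.
Proof.
move=> Cf f01; elim: s => [|k s IH].
  under eq_fun do rewrite big_nil.
  by rewrite big_nil derive_cst normr0.
under eq_fun do rewrite big_cons.
rewrite big_cons (deriveM_C1 _ (Cf k) (C1_prod s Cf))//.
rewrite (le_trans (ler_normD _ _))// lerD//.
  rewrite normrM ler_piMr// ger0_norm ?prodr_ge0//.
    by apply: prodr_ile1 => j _; exact: f01.
  by move=> j _; case/andP: (f01 j).
have /andP[f0 f1] := f01 k.
rewrite normrM (le_trans _ IH)// ler_piMl// ger0_norm//.
Qed.

Lemma prod_ge0_le1 (I : Type) (s : seq I) (f : I -> R) :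
  (forall k, 0 <= f k <= 1) -> 0 <= \prod_(k <- s) f k <= 1.
Proof.
move=> f01; rewrite prodr_ge0/=; last by move=> k _; case/andP: (f01 k).
by apply: prodr_ile1 => k _; exact: f01.
Qed.

Lemma onem_prod_le (I : Type) (s : seq I) (f : I -> R) :
  (forall k, 0 <= f k <= 1) ->
  1 - \prod_(k <- s) f k <= \sum_(k <- s) (1 - f k).
Proof.
move=> f01; elim: s => [|k s IH]; first by rewrite !big_nil subrr.
rewrite !big_cons; have /andP[f0 f1] := f01 k.
have /andP[p0 p1] := prod_ge0_le1 s f01; nra.
Qed.

End C1_functions.

(** * Cutoff functions of class C^1 *)

Section smoothstep.
Context {R : realType}.
Implicit Types t : R.

Definition pos_sq t : R := Num.max 0 t ^+ 2.

Lemma is_derive_pos_sq t : is_derive t (1 : R) pos_sq (2 * Num.max 0 t).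
Proof.
have [t0|t0|->] := ltgtP t 0.
- rewrite ?mulr0.
  apply: (@near_eq_is_derive _ _ _ (cst 0)).
  near=> s; rewrite /pos_sq max_l ?expr0n//= ltW//; near: s.
  exact: lt_nbhsl.
- have D : is_derive t (1 : R) (fun s : R => s ^+ 2) (2 * t).
    apply: DeriveDef; first exact: exprn_derivable.
    by rewrite exp_derive /= expr1 [_%:A]mulr1.
  apply: (near_eq_is_derive _ D); near=> s; rewrite /pos_sq max_r// ltW//.
  by near: s; exact: lt_nbhsr.
- rewrite ?maxxx mulr0.
  have E : (fun h : R => h^-1 *: (pos_sq (h *: (1 : R) + 0) - pos_sq 0)) @ 0^'
      --> (0 : R).
    apply/cvgr0Pnorm_lt => e e0; near=> h.
    rewrite /pos_sq maxxx expr0n/= subr0 addr0 [_ *: 1]mulr1 normrM normfV.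
    have h0 : h != 0 by near: h; exact: nbhs_dnbhs_neq.
    rewrite mulrC ltr_pdivrMr ?normr_gt0// normrX expr2.
    have he : `|h| < e.
      by near: h; exact: dnbhs0_lt.
    have hh : `|Num.max 0 h| <= `|h|.
      by have [|] := leP 0 h; rewrite ?normr0.
    have := normr_ge0 (Num.max 0 h); have := normr_gt0 h; rewrite h0.
    by nra.
  split; first by apply/cvg_ex; exists 0.
  exact: cvg_lim E.
Unshelve. all: by end_near. Qed.

(** A piecewise quadratic transition from 0 to 1 on [0, 1]; its derivative [dstep]
    is the hat function of height 2 on that interval. *)
Definition step t : R :=
  2 * (pos_sq t - 2 * pos_sq (t - 1 / 2) + pos_sq (t - 1)).

Definition dstep t : R :=
  4 * (Num.max 0 t - 2 * Num.max 0 (t - 1 / 2) + Num.max 0 (t - 1)).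

Lemma is_derive_step t : is_derive t (1 : R) step (dstep t).
Proof.
have H (c s : R) : is_derive s (1 : R) (fun s => pos_sq (s - c))
    (2 * Num.max 0 (s - c)).
  have D : is_derive s (1 : R) (fun s => s - c) 1.
    by apply: is_derive_eq; rewrite subr0.
  have := is_derive_comp_line D (is_derive_pos_sq (s - c)).
  by rewrite mulr1.
have H0 := is_derive_pos_sq t; have H1 := H (1 / 2) t; have H2 := H 1 t.
apply: is_derive_eq; rewrite /dstep /GRing.scale/=; ring.
Qed.

Lemma continuous_dstep : continuous dstep.
Proof.
have cp (c : R) : continuous (fun t : R => Num.max 0 (t - c)).
  move=> t; apply: (@continuous_max _ _ (fun=> 0) (fun t : R => t - c) t).
    exact: cst_continuous.
  by apply: cvgB; [exact: cvg_id|exact: cvg_cst].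
move=> t; apply: cvgM; first exact: cvg_cst.
apply: cvgD; last exact: cp.
apply: cvgB; last by apply: cvgM; [exact: cvg_cst|exact: cp].
by have := cp 0 t; rewrite /continuous_at subr0; under eq_fun do rewrite subr0.
Qed.

Lemma step_le0 t : t <= 0 -> step t = 0.
Proof.
move=> t0; rewrite /step /pos_sq !max_l; first ring.
all: lra.
Qed.

Lemma step_ge1 t : 1 <= t -> step t = 1.
Proof.
move=> t1; rewrite /step /pos_sq !max_r; first by field.
all: lra.
Qed.

Lemma step_ge0_le1 t : 0 <= step t <= 1.
Proof.
have [t0|t0] := leP t 0; first by rewrite step_le0// lexx ler01.
have [t1|t1] := leP 1 t; first by rewrite step_ge1// ler01 lexx.
rewrite /step /pos_sq [Num.max 0 t]max_r ?[Num.max 0 (t - 1)]max_l; [|lra..].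
have [h|h] := leP 0 (t - 1 / 2); nra.
Qed.

Lemma dstep_ge0_le2 t : 0 <= dstep t <= 2.
Proof.
rewrite /dstep; have [h0|h0] := leP 0 t; have [h1|h1] := leP 0 (t - 1 / 2);
  have [h2|h2] := leP 0 (t - 1); lra.
Qed.

Lemma dstep_ge1 t : 1 <= t -> dstep t = 0.
Proof. by move=> t1; rewrite /dstep !max_r; lra. Qed.

Lemma dstep_le0 t : t <= 0 -> dstep t = 0.
Proof. by move=> t0; rewrite /dstep !max_l; lra. Qed.

(** A C^1 plateau function: 1 on [-1, 1] and 0 outside ]-2, 2[. *)
Definition plateau t : R := step (2 - t) * step (2 + t).

Definition dplateau t : R :=
  step (2 - t) * dstep (2 + t) - dstep (2 - t) * step (2 + t).

Lemma is_derive_plateau t : is_derive t (1 : R) plateau (dplateau t).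
Proof.
have D1 : is_derive t (1 : R) (fun s => 2 - s) (- 1).
  by apply: is_derive_eq; lra.
have D2 : is_derive t (1 : R) (fun s => 2 + s) 1.
  by apply: is_derive_eq; lra.
have S1 := is_derive_comp_line D1 (is_derive_step (2 - t)).
have S2 := is_derive_comp_line D2 (is_derive_step (2 + t)).
apply: (@is_derive_eq _ _ _ _ _ _ _ _ (is_deriveM S1 S2)).
by rewrite /dplateau /GRing.scale/=; ring.
Qed.

Lemma continuous_step : continuous step.
Proof.
move=> t; apply: differentiable_continuous; apply/derivable1_diffP.
by have [] := is_derive_step t.
Qed.

Lemma continuous_dplateau : continuous dplateau.
Proof.
have c1 (t : R) : {for t, continuous (fun s : R => 2 - s)}.
  by apply: cvgB; [exact: cvg_cst|exact: cvg_id].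
have c2 (t : R) : {for t, continuous (fun s : R => 2 + s)}.
  by apply: cvgD; [exact: cvg_cst|exact: cvg_id].
move=> t.
have s1 : {for t, continuous (fun s : R => step (2 - s))}.
  by apply: (@continuous_comp _ _ _ (fun s : R => 2 - s) step);
    [exact: c1|exact: continuous_step].
have s2 : {for t, continuous (fun s : R => step (2 + s))}.
  by apply: (@continuous_comp _ _ _ (fun s : R => 2 + s) step);
    [exact: c2|exact: continuous_step].
have s3 : {for t, continuous (fun s : R => dstep (2 - s))}.
  by apply: (@continuous_comp _ _ _ (fun s : R => 2 - s) dstep);
    [exact: c1|exact: continuous_dstep].
have s4 : {for t, continuous (fun s : R => dstep (2 + s))}.
  by apply: (@continuous_comp _ _ _ (fun s : R => 2 + s) dstep);
    [exact: c2|exact: continuous_dstep].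
exact: cvgB (cvgM s1 s4) (cvgM s3 s2).
Qed.

Lemma plateau_ge0_le1 t : 0 <= plateau t <= 1.
Proof.
have /andP[a0 a1] := step_ge0_le1 (2 - t).
have /andP[b0 b1] := step_ge0_le1 (2 + t).
by rewrite mulr_ge0//= mulr_ile1.
Qed.

Lemma plateau1 t : `|t| <= 1 -> plateau t = 1.
Proof.
rewrite ler_norml => /andP[t1 t2].
by rewrite /plateau !step_ge1 ?mulr1//; lra.
Qed.

Lemma plateau0 t : 2 <= `|t| -> plateau t = 0.
Proof.
rewrite ler_normr => /orP[t2|t2]; rewrite /plateau.
  by rewrite step_le0 ?mul0r//; lra.
by rewrite [X in _ * X]step_le0 ?mulr0//; lra.
Qed.

Lemma dplateau_le4 t : `|dplateau t| <= 4.
Proof.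
have /andP[a0 a1] := step_ge0_le1 (2 - t).
have /andP[b0 b1] := step_ge0_le1 (2 + t).
have /andP[c0 c1] := dstep_ge0_le2 (2 - t).
have /andP[d0 d1] := dstep_ge0_le2 (2 + t).
rewrite /dplateau ler_norml; apply/andP; split; nra.
Qed.

End smoothstep.

Section bump.
Context {R : realType} {d : nat}.
Implicit Types (c x : 'rV[R]_d) (r : R).

Definition bump c r x : R := \prod_j plateau ((x 0 j - c 0 j) / r).

Let bump1 c r j x := plateau ((x 0 j - c 0 j) / r).

Let C1_scaled U c r j : open U -> C1 U (fun x => (x 0 j - c 0 j) / r).
Proof.
move=> oU; apply: C1M => //; last exact: C1_cst.
by apply: C1B => //; [exact: C1_coord|exact: C1_cst].
Qed.

Let C1_bump1 c r j : C1 setT (bump1 c r j).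
Proof.
apply: (C1_comp is_derive_plateau continuous_dplateau) => //; first exact: openT.
by apply: C1_scaled; exact: openT.
Qed.

Lemma C1_bump c r : C1 setT (bump c r).
Proof. by apply: C1_prod => j; exact: C1_bump1. Qed.

Lemma bump_ge0_le1 c r x : 0 <= bump c r x <= 1.
Proof. by apply: prod_ge0_le1 => j; exact: plateau_ge0_le1. Qed.

Lemma bump_eq1 c r x : 0 < r -> ball c r x -> bump c r x = 1.
Proof.
move=> r0 [_ cx]; rewrite /bump big1// => j _; apply: plateau1.
rewrite normrM normfV (gtr0_norm r0) ler_pdivrMr// mul1r distrC.
by have := cx 0 j; rewrite /ball/= => /ltW.
Qed.

Lemma bump_eq0 c r x : 0 < r -> ~ ball c (2 * r) x -> bump c r x = 0.
Proof.
move=> r0 cx; have [j cxj] : exists j, 2 * r <= `|x 0 j - c 0 j|.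
  apply: contrapT => H; apply: cx; split; first by rewrite mulr_gt0.
  move=> i j; rewrite (ord1 i) /ball/= distrC ltNge; apply/negP => h.
  by apply: H; exists j.
rewrite /bump (bigD1 j)//= plateau0 ?mul0r//.
by rewrite normrM normfV (gtr0_norm r0) ler_pdivlMr.
Qed.

Lemma derive_bump_le c r i x : 0 < r -> `|'D_(base i) (bump c r) x| <= 4 / r.
Proof.
move=> r0; rewrite (le_trans (derive_prod_le _ _ _ _))//.
- exact: C1_bump1.
- by move=> j; exact: plateau_ge0_le1.
rewrite (bigD1 i)//= big1 ?addr0; last first.
  move=> j ji.
  rewrite (derive_comp_C1 i is_derive_plateau (C1_scaled c r j openT))//.
  rewrite (deriveM_C1 (U := setT))//; last 2 first.
  - by apply: C1B; [exact: openT|apply: C1_coord; exact: openT|exact: C1_cst].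
  - exact: C1_cst.
  rewrite derive_cst mulr0 addr0 (deriveB_C1 (U := setT))//; last 2 first.
  - by apply: C1_coord; exact: openT.
  - exact: C1_cst.
  rewrite derive_cst subr0; have [_ ->] := is_derive_coord j i x.
  by rewrite eq_sym (negbTE ji) mul0r mulr0 normr0.
rewrite (derive_comp_C1 i is_derive_plateau (C1_scaled c r i openT))//.
rewrite (deriveM_C1 (U := setT))//; last 2 first.
- by apply: C1B; [exact: openT|apply: C1_coord; exact: openT|exact: C1_cst].
- exact: C1_cst.
rewrite derive_cst mulr0 addr0 (deriveB_C1 (U := setT))//; last 2 first.
- by apply: C1_coord; exact: openT.
- exact: C1_cst.
rewrite derive_cst subr0; have [_ ->] := is_derive_coord i i x.
rewrite eqxx mul1r normrM normfV (gtr0_norm r0) ler_wpM2r ?invr_ge0 ?(ltW r0)//.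
exact: dplateau_le4.
Qed.

End bump.

(** * Fields tangent to the boundary: local analysis *)

Section cubes.
Context {R : realType} {d : nat}.
Implicit Types (x y : 'rV[R]_d) (e : R) (f g : 'rV[R]_d -> R).

Local Notation leb := (lebesgue_rV d).

Lemma cbox_cubeP x e y :
  cbox (lo x e) (hi x e) y <-> forall i, `|x 0 i - y 0 i| <= e.
Proof.
by split=> xy i; have := xy i; rewrite !mxE ler_distlC.
Qed.

Lemma cbox_ball x e e' : e < e' -> 0 < e' -> cbox (lo x e) (hi x e) `<=` ball x e'.
Proof.
move=> ee' e0 y /cbox_cubeP xy; split=> // i j.
by rewrite (ord1 i) /ball/= (le_lt_trans (xy j)).
Qed.

Lemma nbhs_cube x (P : set 'rV[R]_d) : nbhs x P ->
  exists2 e, 0 < e & cbox (lo x e) (hi x e) `<=` P.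
Proof.
move=> /nbhs_ballP[e /= e0 eP]; exists (e / 2); first by rewrite divr_gt0.
apply: subset_trans eP; apply: cbox_ball => //.
by rewrite ltr_pdivrMr// ltr_pMr// ltr1n.
Qed.

Lemma integral_derive_cube x e s V g i : 0 < s -> s < e -> open V ->
  cbox (lo x e) (hi x e) `<=` V -> C1 V g ->
  (forall y, ~ ball x s y -> g y = 0) ->
  \int[leb]_(y in ball x e) 'D_(base i) g y = 0.
Proof.
move=> s0 se oV xV [cg dg cdg] g0; have e0 := lt_trans s0 se.
rewrite ball_cube// /Rintegral (@integral_derive_box _ _ _ _ V)//.
- by move=> j; rewrite !mxE; lra.
- by move=> y Vy; exact: dg.
- by move=> y Vy; exact: cdg.
- move=> y _; rewrite !mxE => yi; rewrite [RHS]g0 ?g0// => -[_ /(_ 0 i)];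
    rewrite /ball/= ?[_ 0 i]mxE ltNge => /negP; apply; rewrite ler_normr; apply/orP.
    by right; rewrite !mxE yi !eqxx /= mulr1; lra.
  by left; rewrite yi; lra.
Qed.

Lemma Rintegral_sum D (I : Type) (s : seq I) (f : I -> 'rV[R]_d -> R) :
  measurable D -> (forall i, leb.-integrable D (EFin \o f i)) ->
  leb.-integrable D (EFin \o (fun x => \sum_(i <- s) f i x)) /\
  \int[leb]_(x in D) (\sum_(i <- s) f i x) =
  \sum_(i <- s) \int[leb]_(x in D) f i x.
Proof.
move=> mD intf; elim: s => [|i s [IH1 IH2]].
  split.
    rewrite (_ : _ \o _ = cst 0%E); first exact: integrable0.
    by apply/funext => x /=; rewrite big_nil.
  under eq_Rintegral do rewrite big_nil.
  by rewrite Rintegral_cst// mul0r big_nil.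
have E : (fun x => \sum_(j <- i :: s) f j x) =
    (fun x => f i x + \sum_(j <- s) f j x).
  by apply/funext => x; rewrite big_cons.
rewrite E; split; last by rewrite RintegralD// IH2 big_cons.
exact: (integrableD mD (intf i) IH1).
Qed.

End cubes.

Lemma continuousM_at (R : realType) (T : topologicalType) (f g : T -> R) x :
  {for x, continuous f} -> {for x, continuous g} ->
  {for x, continuous (fun y => f y * g y)}.
Proof. by move=> cf cg; exact: cvgM cf cg. Qed.

Lemma continuous_norm_at (R : realType) (T : topologicalType) (f : T -> R) x :
  {for x, continuous f} -> {for x, continuous (fun y => `|f y|)}.
Proof. by move=> cf; exact: cvg_norm cf. Qed.

(** The margin between the radii [s] and [e] gives a neighbourhood, on which the
    derivatives vanish too. *)
Lemma vanish_open (R : realType) (d : nat) (f : 'rV[R]_d -> R) x e s y :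
  s < e -> (forall y, ~ ball x s y -> f y = 0) -> ~ ball x e y ->
  exists V, [/\ open V, V y & forall z, V z -> f z = 0].
Proof.
move=> se f0 xy; have [e0|e0] := leP e 0.
  exists setT; split=> //; first exact: openT.
  by move=> z _; apply: f0 => -[]; rewrite ltNge (le_trans (ltW se)).
exists (ball y (e - s)); split.
- exact: ball_open.
- by apply: ballxx; rewrite subr_gt0.
- move=> z yz; apply: f0 => xz; apply: xy.
  rewrite (_ : e = s + (e - s)); last by rewrite addrC subrK.
  by apply: ball_triangle xz _; exact: ball_sym.
Qed.

(** The divergence of [phi] times the field [W], expanded by the product rule so
    that it is visibly linear in [phi]. *)
Definition div_scale (R : realType) (d : nat) (W : 'I_d -> 'rV[R]_d -> R)
    (phi : 'rV[R]_d -> R) (x : 'rV[R]_d) : R :=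
  \sum_i ('D_(base i) phi x * W i x + phi x * 'D_(base i) (W i) x).

(** Formally, the flux of the field [phi W] through the boundary. *)
Definition int_div (R : realType) (d : nat) (Omega : set 'rV[R]_d)
    (W : 'I_d -> 'rV[R]_d -> R) (phi : 'rV[R]_d -> R) : R :=
  \int[lebesgue_rV d]_(x in Omega) div_scale W phi x.

Section tangential.
Context {R : realType} {d : nat}.
Variables (Omega U : set 'rV[R]_d) (W : 'I_d -> 'rV[R]_d -> R).
Hypotheses (oOmega : open Omega) (bOmega : bounded_set Omega).
Hypotheses (oU : open U) (OmegaU : closure Omega `<=` U).
Hypothesis CW : forall i, C1 U (W i).
Implicit Types (x y : 'rV[R]_d) (phi psi : 'rV[R]_d -> R).

Local Notation leb := (lebesgue_rV d).

Local Notation divM := (div_scale W).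
Local Notation flux := (int_div Omega W).

Lemma finite_bounded (D : set 'rV[R]_d) : measurable D -> bounded_set D ->
  (leb D < +oo)%E.
Proof.
move=> mD [M [_ DM]].
apply: (@le_lt_trans _ _ (leb (box (lo 0 (`|M| + 2)) (hi 0 (`|M| + 2))))).
  apply: le_measure; rewrite ?inE//; first exact: measurable_box.
  rewrite -ball_cube; last by rewrite ltr_wpDl.
  move=> y Dy; rewrite -ball_normE/= sub0r normrN.
  apply: (@le_lt_trans _ _ (`|M| + 1)); last by rewrite ltrD2l ltr1n.
  by apply: (DM (`|M| + 1)) => //; rewrite (le_lt_trans (ler_norm M))// ltrDl.
exact: finite_box.
Qed.

Lemma compact_closure_bounded : compact (closure Omega).
Proof.
have [a [b Oab]] : exists a b, Omega `<=` cbox a b.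
  have [M [_ OM]] := bOmega.
  exists (lo 0 (`|M| + 1)), (hi 0 (`|M| + 1)) => y Oy; apply/cbox_cubeP => i.
  rewrite mxE sub0r normrN.
  apply: (@le_trans _ _ `|y|).
    rewrite [leRHS]/Num.norm/= mx_normrE.
    by apply: (@le_bigmax _ _ _ 0 (fun ij => `|y ij.1 ij.2|) (0, i)).
  by apply: (OM (`|M| + 1)) => //; rewrite (le_lt_trans (ler_norm M))// ltrDl.
apply: (subclosed_compact _ (@compact_cbox _ _ a b)); first exact: closed_closure.
have cab : closed (cbox a b).
  exact: compact_closed (@norm_hausdorff _ _) (@compact_cbox _ _ a b).
by rewrite [X in _ `<=` X](closure_id _).1//; exact: closure_subset.
Qed.

Lemma continuous_closure_integrable (f : 'rV[R]_d -> R) :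
  (forall x, closure Omega x -> {for x, continuous f}) ->
  leb.-integrable Omega (EFin \o f).
Proof.
move=> cf; have mO := open_measurable_rV oOmega.
apply: measurable_bounded_integrable => //.
- exact: finite_bounded.
- apply: continuous_measurable_rV => // x Ox; apply: cf; exact: subset_closure.
- have [M _ fM] := continuous_compact_bounded compact_closure_bounded cf.
  exists M; split; first exact: num_real.
  by move=> N MN x /subset_closure Ox; exact: le_trans (fM _ Ox) (ltW MN).
Qed.

Lemma divM_C1 V phi x : open V -> V `<=` U -> C1 V phi -> V x ->
  divM phi x = \sum_i 'D_(base i) (fun y => phi y * W i y) x.
Proof.
move=> oV VU Cphi Vx; apply: eq_bigr => i _.
by rewrite (deriveM_C1 i Cphi (C1S VU (CW i))).
Qed.

Lemma continuous_sum_rV (I : Type) (s : seq I) (f : I -> 'rV[R]_d -> R) x :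
  (forall i, {for x, continuous (f i)}) ->
  {for x, continuous (fun y => \sum_(i <- s) f i y)}.
Proof.
move=> cf; elim: s => [|i s IH].
  rewrite (_ : (fun y => _) = cst 0); first exact: cst_continuous.
  by apply/funext => y; rewrite big_nil.
rewrite (_ : (fun y => _) = (fun y => f i y + \sum_(j <- s) f j y)).
  exact: cvgD (cf i) IH.
by apply/funext => y; rewrite big_cons.
Qed.

Lemma continuous_divM V phi x : V `<=` U -> C1 V phi -> V x ->
  {for x, continuous (divM phi)}.
Proof.
move=> VU [cp dp cdp] Vx; apply: continuous_sum_rV => i.
have [cW dW cdW] := C1S VU (CW i).
exact: cvgD (cvgM (cdp i _ Vx) (cW _ Vx)) (cvgM (cp _ Vx) (cdW i _ Vx)).
Qed.

Lemma divM_integrable phi : C1 setT phi -> leb.-integrable Omega (EFin \o divM phi).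
Proof.
move=> Cphi; apply: continuous_closure_integrable => x /OmegaU.
by apply: continuous_divM => //; exact: C1S Cphi.
Qed.

Lemma divMB phi psi x : C1 setT phi -> C1 setT psi ->
  divM (fun y => phi y - psi y) x = divM phi x - divM psi x.
Proof.
move=> Cphi Cpsi; rewrite /div_scale -sumrB; apply: eq_bigr => i _.
by rewrite (deriveB_C1 i Cphi Cpsi)//; ring.
Qed.

Lemma fluxB phi psi : C1 setT phi -> C1 setT psi ->
  flux (fun y => phi y - psi y) = flux phi - flux psi.
Proof.
move=> Cphi Cpsi; rewrite /int_div -RintegralB//; last 3 first.
- exact: open_measurable_rV.
- exact: divM_integrable.
- exact: divM_integrable.
by apply: eq_Rintegral => x _; rewrite divMB.
Qed.

Lemma divM_eq0 phi x V : open V -> V x -> (forall y, V y -> phi y = 0) ->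
  divM phi x = 0.
Proof.
move=> oV Vx phi0; rewrite /div_scale big1// => i _.
rewrite (@near_eq_derive _ _ _ _ (cst 0)).
  by rewrite derive_cst mul0r phi0// mul0r addr0.
have Vnx : nbhs x V by exact: open_nbhs_nbhs.
exact: filterS phi0 Vnx.
Qed.

Lemma divM_supp phi x e s y : s < e -> (forall y, ~ ball x s y -> phi y = 0) ->
  ~ ball x e y -> divM phi y = 0.
Proof.
by move=> se phi0 /(vanish_open se phi0)[V [oV Vy V0]]; exact: divM_eq0 oV Vy V0.
Qed.

Lemma flux_ball phi x e s : s < e -> (forall y, ~ ball x s y -> phi y = 0) ->
  flux phi = \int[leb]_(y in Omega `&` ball x e) divM phi y.
Proof.
move=> se phi0; rewrite Rintegral_mkcondr; apply: eq_Rintegral => y _.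
rewrite patchE; case: ifPn => // /negP xy; rewrite (divM_supp se phi0)//.
by move=> yx; apply: xy; rewrite inE.
Qed.

(** The field [phi W] vanishes near the faces of a cube contained in the domain, so
    each of its partial derivatives has integral 0 over that cube. *)
Lemma flux_interior x e s phi : 0 < s -> s < e ->
  cbox (lo x e) (hi x e) `<=` Omega ->
  C1 setT phi -> (forall y, ~ ball x s y -> phi y = 0) -> flux phi = 0.
Proof.
move=> s0 se xO Cphi phi0; have e0 := lt_trans s0 se.
rewrite (flux_ball se phi0) setIC setIidl; last first.
  by rewrite ball_cube//; apply: subset_trans xO; exact: box_cbox.
have OU : Omega `<=` U by move=> y /subset_closure/OmegaU.
have CO i : C1 Omega (fun y => phi y * W i y).
  by apply: C1M => //; [exact: C1S Cphi|exact: C1S (CW i)].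
rewrite (@eq_Rintegral _ _ _ _ _ (fun y =>
    \sum_i 'D_(base i) (fun y => phi y * W i y) y)); last first.
  move=> y /set_mem; rewrite ball_cube// => /box_cbox/xO Oy.
  by rewrite (divM_C1 oOmega OU)//; exact: C1S Cphi.
have mB : measurable (ball x e : set 'rV[R]_d).
  by apply: open_measurable_rV; exact: ball_open.
have intB i : leb.-integrable (ball x e)
    (EFin \o 'D_(base i) (fun y => phi y * W i y)).
  rewrite ball_cube//; apply: continuous_box_integrable => y /xO Oy.
  by have [_ _] := CO i; exact.
rewrite (Rintegral_sum (index_enum 'I_d) mB intB).2 big1// => i _.
apply: (integral_derive_cube _ s0 se oOmega xO (CO i)).
by move=> y xy; rewrite phi0// mul0r.
Qed.


Lemma cube_integrable x e f : 0 < e ->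
  (forall y, cbox (lo x e) (hi x e) y -> {for y, continuous f}) ->
  leb.-integrable (ball x e) (EFin \o f).
Proof. by move=> e0 cf; rewrite ball_cube//; exact: continuous_box_integrable. Qed.

(** The function |rho| + max(0, eps - |k|) is continuous and positive on the compact
    cube; its minimum is a suitable delta. *)
Lemma uniform_tangency x e (rho k : 'rV[R]_d -> R) (eps : R) : 0 < e ->
  (forall y, cbox (lo x e) (hi x e) y -> {for y, continuous rho}) ->
  (forall y, cbox (lo x e) (hi x e) y -> {for y, continuous k}) ->
  (forall y, cbox (lo x e) (hi x e) y -> rho y = 0 -> k y = 0) ->
  0 < eps ->
  exists2 delta, 0 < delta & forall y, cbox (lo x e) (hi x e) y ->
    `|rho y| < delta -> `|k y| <= eps.
Proof.
move=> e0 cr ck rk eps0.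
pose F y := `|rho y| + Num.max 0 (eps - `|k y|).
have F0 y : cbox (lo x e) (hi x e) y -> 0 < F y.
  move=> xy; rewrite /F; have [/eqP ry|ry] := boolP (rho y == 0).
    by rewrite ry normr0 add0r (rk _ xy ry) normr0 subr0 lt_max eps0 orbT.
  by rewrite ltr_pwDl ?normr_gt0// le_max lexx.
have xx : cbox (lo x e) (hi x e) !=set0.
  by exists x; apply/cbox_cubeP => i; rewrite subrr normr0 ltW.
have cF : {within cbox (lo x e) (hi x e), continuous F}.
  apply: continuous_in_subspaceT => y; rewrite inE => xy.
  have c1 : {for y, continuous (fun y => `|rho y|)} by exact: cvg_norm (cr _ xy).
  have c2 : {for y, continuous (fun y => eps - `|k y|)}.
    exact: cvgB (cvg_cst _) (cvg_norm (ck _ xy)).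
  have c3 : {for y, continuous (fun y => Num.max 0 (eps - `|k y|))}.
    by apply: (@continuous_max _ _ (fun=> 0) _ y _ c2); exact: cst_continuous.
  exact: cvgD c1 c3.
have [c] := EVT_min_rV xx (@compact_cbox _ _ _ _) cF.
rewrite inE => xc Fc; exists (F c); first exact: F0.
move=> y xy ry; rewrite leNgt; apply/negP => ky.
have := Fc y; rewrite inE => /(_ xy); rewrite /F [Num.max 0 (eps - `|k y|)]max_l.
  by rewrite addr0 leNgt ry.
by rewrite subr_le0 ltW.
Qed.

(** Near a regular boundary point the domain is {rho < 0}. The indicator function
    of the domain is approximated by [hr m], a C^1 function of [rho] that goes from
    1 to 0 in the layer -1/m < rho < 0. The scalar product [k] of the field with
    grad rho is continuous and vanishes on {rho = 0}, hence is small in the layer,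
    and the integral over the layer of the derivative [dh m] of the cutoff is
    bounded independently of [m]. *)
Section regular_boundary_point.
Variables (x : 'rV[R]_d) (e : R) (V : set 'rV[R]_d) (rho : 'rV[R]_d -> R).
Variables (i0 : 'I_d) (sg c : R).
Hypotheses (e0 : 0 < e) (oV : open V) (VU : V `<=` U).
Hypothesis xV : cbox (lo x e) (hi x e) `<=` V.
Hypothesis Crho : C1 V rho.
Hypothesis OmegaV : forall y, V y -> (Omega y <-> rho y < 0).
Hypotheses (sg1 : `|sg| = 1) (c0 : 0 < c).
Hypothesis drho : forall y, cbox (lo x e) (hi x e) y ->
  c <= sg * 'D_(base i0) rho y.

Let k y := \sum_j W j y * 'D_(base j) rho y.

Hypothesis tangent : forall y, cbox (lo x e) (hi x e) y -> rho y = 0 -> k y = 0.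

Variable phi : 'rV[R]_d -> R.
Hypotheses (Cphi : C1 setT phi) (phi0 : forall y, ~ ball x (e / 4) y -> phi y = 0).

Let B : set 'rV[R]_d := ball x e.
Let Q : set 'rV[R]_d := cbox (lo x e) (hi x e).

Let BQ : B `<=` Q.
Proof. by rewrite /B ball_cube//; exact: box_cbox. Qed.

Let mB : measurable B.
Proof. by apply: open_measurable_rV; exact: ball_open. Qed.

Let CV i : C1 V (W i). Proof. exact: C1S VU (CW i). Qed.
Let CphiV : C1 V phi. Proof. exact: C1S Cphi. Qed.

Let h (m t : R) : R := step (- m * t).
Let dh (m t : R) : R := - m * dstep (- m * t).

Let is_derive_line (m t : R) : is_derive t (1 : R) (fun t => - m * t) (- m).
Proof. by apply: is_derive_eq; rewrite [_%:A]mulr1. Qed.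

Let Dh m t : is_derive t (1 : R) (h m) (dh m t).
Proof.
have := is_derive_comp_line (is_derive_line m t) (is_derive_step (- m * t)).
by rewrite mulrC.
Qed.

Let continuous_dh m : continuous (dh m).
Proof.
move=> t; apply: (cvgM (cvg_cst _)).
apply: (@continuous_comp _ _ _ (fun t : R => - m * t) dstep).
  by apply: cvgM; [exact: cvg_cst|exact: cvg_id].
exact: continuous_dstep.
Qed.

Let hr m y := h m (rho y).

Let Chr m : C1 V (hr m).
Proof. exact: (C1_comp (Dh m) (@continuous_dh m) oV Crho). Qed.

Let derive_hr m j y : V y ->
  'D_(base j) (hr m) y = dh m (rho y) * 'D_(base j) rho y.
Proof. exact: (derive_comp_C1 j (Dh m) Crho). Qed.

Let continuous_k y : Q y -> {for y, continuous k}.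
Proof.
move=> /xV Vy; apply: continuous_sum_rV => j.
have [cW _ _] := CV j; have [_ _ cdr] := Crho.
exact: continuousM_at (cW _ Vy) (cdr j _ Vy).
Qed.

Let continuous_dhr m y : Q y -> {for y, continuous (fun y => dh m (rho y))}.
Proof.
move=> /xV Vy; have [cr _ _] := Crho.
apply: (@continuous_comp _ _ _ rho (dh m)); first exact: cr.
exact: continuous_dh.
Qed.

(** The divergence theorem on the cube for the field [hr m * phi * W], which is C^1
    and vanishes near the faces. *)
Let integral_cutoff m :
  \int[leb]_(y in B) (hr m y * divM phi y) =
  - \int[leb]_(y in B) (phi y * k y * dh m (rho y)).
Proof.
have CG j : C1 V (fun y => hr m y * (phi y * W j y)).
  exact: (C1M oV (Chr m) (C1M oV CphiV (CV j))).
have intG j : leb.-integrable B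
    (EFin \o 'D_(base j) (fun y => hr m y * (phi y * W j y))).
  apply: cube_integrable => // y /xV Vy.
  by have [_ _] := CG j; exact.
have int1 : leb.-integrable B (EFin \o (fun y => hr m y * divM phi y)).
  apply: cube_integrable => // y /xV Vy.
  have [ch _ _] := Chr m.
  exact: continuousM_at (ch _ Vy) (continuous_divM VU CphiV Vy).
have int2 : leb.-integrable B (EFin \o (fun y => phi y * k y * dh m (rho y))).
  apply: cube_integrable => // y Qy; have [cp _ _] := CphiV.
  apply: (continuousM_at _ (@continuous_dhr m _ Qy)).
  exact: continuousM_at (cp _ (xV Qy)) (continuous_k Qy).
apply/eqP; rewrite -addr_eq0 -RintegralD//; apply/eqP.
transitivity (\int[leb]_(y in B)
    \sum_j 'D_(base j) (fun y => hr m y * (phi y * W j y)) y).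
  apply: eq_Rintegral => y /set_mem/BQ/xV Vy.
  rewrite (divM_C1 oV VU CphiV Vy) mulr_sumr [phi y * k y]mulr_sumr mulr_suml.
  rewrite -big_split/=; apply: eq_bigr => j _.
  rewrite (deriveM_C1 j (Chr m) (C1M oV CphiV (CV j)) Vy) derive_hr//; ring.
rewrite (Rintegral_sum (index_enum 'I_d) mB intG).2 big1// => j _.
have e4 : 0 < e / 4 by rewrite divr_gt0.
have e41 : e / 4 < e by lra.
apply: (integral_derive_cube _ e4 e41 oV xV (CG j)).
by move=> y xy; rewrite phi0// mul0r mulr0.
Qed.

Let cut := bump x (e / 4).

(** Up to the factor d_i rho, whose absolute value is at least [c] on the cube,
    [dh m] is the i-th derivative of [hr m]. Integrating by parts moves this
    derivative to [cut]; this replaces an estimate of the volume of the layer. *)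
Let integral_dh m :
  `|\int[leb]_(y in B) (cut y * dh m (rho y) * 'D_(base i0) rho y)| <=
  \int[leb]_(y in B) `|'D_(base i0) cut y|.
Proof.
have e4 : 0 < e / 4 by rewrite divr_gt0.
have Ccut : C1 V cut by apply: C1S (C1_bump x (e / 4)).
have CG : C1 V (fun y => cut y * hr m y) by exact: (C1M oV Ccut (Chr m)).
have [cc _ cdc] := Ccut; have [ch _ cdh'] := Chr m; have [_ _ cdr] := Crho.
have int1 : leb.-integrable B
    (EFin \o (fun y => cut y * dh m (rho y) * 'D_(base i0) rho y)).
  apply: cube_integrable => // y Qy.
  apply: (continuousM_at _ (cdr i0 _ (xV Qy))).
  exact: continuousM_at (cc _ (xV Qy)) (@continuous_dhr m _ Qy).
have int2 : leb.-integrable B (EFin \o (fun y => 'D_(base i0) cut y * hr m y)).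
  apply: cube_integrable => // y Qy.
  exact: continuousM_at (cdc i0 _ (xV Qy)) (ch _ (xV Qy)).
have int3 : leb.-integrable B (EFin \o (fun y => `|'D_(base i0) cut y|)).
  apply: cube_integrable => // y Qy; exact: continuous_norm_at (cdc i0 _ (xV Qy)).
have -> : \int[leb]_(y in B) (cut y * dh m (rho y) * 'D_(base i0) rho y) =
    - \int[leb]_(y in B) ('D_(base i0) cut y * hr m y).
  apply/eqP; rewrite -addr_eq0 -RintegralD//; apply/eqP.
  transitivity (\int[leb]_(y in B) 'D_(base i0) (fun y => cut y * hr m y) y).
    apply: eq_Rintegral => y /set_mem/BQ/xV Vy.
    rewrite (deriveM_C1 i0 Ccut (Chr m) Vy) derive_hr//; ring.
  have e2 : 0 < e / 2 by rewrite divr_gt0.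
  have e21 : e / 2 < e by lra.
  apply: (integral_derive_cube _ e2 e21 oV xV CG) => y xy.
  rewrite /cut bump_eq0 ?mul0r//.
  by rewrite (_ : 2 * (e / 4) = e / 2)//; lra.
rewrite normrN (le_trans (le_normr_Rintegral mB int2))//.
apply: le_Rintegral => //.
  apply: cube_integrable => // y Qy.
  exact: continuous_norm_at (continuousM_at (cdc i0 _ (xV Qy)) (ch _ (xV Qy))).
move=> y _; rewrite normrM ler_piMr// ger0_norm.
  by case/andP: (step_ge0_le1 (- m * rho y)).
by case/andP: (step_ge0_le1 (- m * rho y)).
Qed.

Let flux_cube : flux phi = \int[leb]_(y in B) (divM phi \_ Omega) y.
Proof.
have e41 : e / 4 < e by rewrite ltr_pdivrMr// ltr_pMr// ltr1n.
by rewrite (flux_ball e41 phi0) Rintegral_mkcondl.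
Qed.

(** Dominated convergence: [hr m] tends pointwise to the indicator function of
    {rho < 0}. *)
Let cvg_cutoff :
  \int[leb]_(y in B) (hr n%:R y * divM phi y) @[n --> \oo] --> flux phi.
Proof.
have int0 : leb.-integrable B (EFin \o divM phi).
  by apply: cube_integrable => // y /xV Vy; exact: continuous_divM VU CphiV Vy.
have int1 m : leb.-integrable B (EFin \o (fun y => hr m y * divM phi y)).
  apply: cube_integrable => // y /xV Vy; have [ch _ _] := Chr m.
  exact: continuousM_at (ch _ Vy) (continuous_divM VU CphiV Vy).
have int2 : leb.-integrable B (EFin \o (divM phi \_ Omega)).
  rewrite -restrict_EFin.
  have mO := open_measurable_rV oOmega.
  apply: (@integrable_restrict _ _ _ leb Omega mO B mB (EFin \o divM phi)).1.
  by apply: (integrableS mB _ _ int0); [exact: measurableI|exact: subIsetl].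
rewrite flux_cube; apply: fine_cvg.
rewrite fineK; last exact: integrable_fin_num.
apply: (@dominated_cvg _ _ _ leb B mB
  (fun n y => (hr n%:R y * divM phi y)%:E) _ (fun y => `|divM phi y|%:E)).
- by move=> n; exact: measurable_int (int1 _).
- move=> y By; apply: cvg_EFin; first exact: nearW.
  rewrite patchE; have Vy := xV (BQ By); case: ifPn => [/set_mem Oy|/negP Oy].
    have ry : rho y < 0 by apply/OmegaV.
    apply: cvg_near_cst; near=> n.
    rewrite /= /hr /h step_ge1 ?mul1r//.
    have rn : (- rho y)^-1 <= n%:R by near: n; exact: nbhs_infty_ger.
    by rewrite mulNr -mulrN -ler_pdivrMr ?oppr_gt0// mul1r.
  have ry : 0 <= rho y.
    by rewrite leNgt; apply/negP => ry; apply: Oy; apply/mem_set/OmegaV.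
  apply: cvg_near_cst; near=> n; rewrite /= /hr /h step_le0 ?mul0r//.
  by rewrite mulNr oppr_le0 mulr_ge0.
- by move=> y _.
- by have := integrable_norm int0.
- move=> n y _; rewrite lee_fin normrM ler_piMl// ger0_norm.
    by case/andP: (step_ge0_le1 (- n%:R * rho y)).
  by case/andP: (step_ge0_le1 (- n%:R * rho y)).
Unshelve. all: by end_near. Qed.

Lemma flux_regular : flux phi = 0.
Proof.
have e4 : 0 < e / 4 by rewrite divr_gt0.
have [cp _ _] := CphiV; have [cr _ cdr] := Crho.
have [M M0 phiM] := continuous_compact_bounded (@compact_cbox _ _ _ _)
  (fun y Qy => cp y (xV Qy)).
pose D := \int[leb]_(y in B) `|'D_(base i0) cut y|.
have D0 : 0 <= D by apply: Rintegral_ge0.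
(* [M] bounds phi, and [D] bounds the integral of [cut * dh m * d_i rho]. *)
suff H eps : 0 < eps -> `|flux phi| <= eps * (M / c * D).
  apply/eqP; rewrite -normr_le0; apply/ler_addgt0Pr => eps eps0; rewrite add0r.
  have K0 : 0 < M / c * D + 1 by rewrite ltr_wpDl// mulr_ge0// divr_ge0// ltW.
  rewrite (le_trans (H (eps / (M / c * D + 1)) _)) ?divr_gt0//.
  by rewrite mulrAC ler_pdivrMr// ler_pM2l// lerDl.
move=> eps0.
have [delta delta0 kd] := uniform_tangency e0
  (fun y Qy => cr y (xV Qy)) continuous_k tangent eps0.
apply: (cvgr_to_le (cvg_norm cvg_cutoff)).
near=> n; pose m : R := n%:R.
have m0 : 0 < m.
  by rewrite ltr0n; near: n; exact: nbhs_infty_gt.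
have mdelta : delta^-1 <= n%:R by near: n; exact: nbhs_infty_ger.
rewrite -/m integral_cutoff normrN.
have Ccut : C1 V cut by apply: C1S (C1_bump x (e / 4)).
have [cc _ _] := Ccut.
have int1 : leb.-integrable B (EFin \o (fun y => phi y * k y * dh m (rho y))).
  apply: cube_integrable => // y Qy.
  apply: (continuousM_at _ (@continuous_dhr m _ Qy)).
  exact: continuousM_at (cp _ (xV Qy)) (continuous_k Qy).
have int2 : leb.-integrable B
    (EFin \o (fun y => cut y * dh m (rho y) * 'D_(base i0) rho y)).
  apply: cube_integrable => // y Qy.
  apply: (continuousM_at _ (cdr i0 _ (xV Qy))).
  exact: continuousM_at (cc _ (xV Qy)) (@continuous_dhr m _ Qy).
rewrite (le_trans (le_normr_Rintegral mB int1))//.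
have dh_le0 t : dh m t <= 0.
  by rewrite /dh mulNr oppr_le0 mulr_ge0 ?(ltW m0)//; case/andP: (dstep_ge0_le2 (- m * t)).
apply: (@le_trans _ _ (\int[leb]_(y in B)
   (- (eps * (M / c) * sg) * (cut y * dh m (rho y) * 'D_(base i0) rho y)))).
  apply: le_Rintegral => //.
  - apply: cube_integrable => // y Qy; apply: continuous_norm_at.
    apply: (continuousM_at _ (@continuous_dhr m _ Qy)).
  exact: continuousM_at (cp _ (xV Qy)) (continuous_k Qy).
  - by have := integrableZl mB (- (eps * (M / c) * sg)) int2.
  - move=> y By; have Qy := BQ By.
    set a := dh m (rho y); have a0 : a <= 0 by exact: dh_le0.
    have dr := drho Qy; set r := 'D_(base i0) rho y in dr *.
    have cut0 : 0 <= cut y by case/andP: (bump_ge0_le1 x (e / 4) y).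
    have -> : - (eps * (M / c) * sg) * (cut y * a * r) =
        eps * M * (cut y * - a) * ((sg * r) / c).
      by field; rewrite gt_eqF.
    have rc : 1 <= (sg * r) / c by rewrite ler_pdivlMr// mul1r.
    have Ma : 0 <= eps * M * (cut y * - a).
      by rewrite !mulr_ge0 ?oppr_ge0// ltW.
    apply: (@le_trans _ _ (eps * M * (cut y * - a))); last by rewrite ler_peMr.
    have [py|/phi0 ->] := pselect (ball x (e / 4) y); last first.
      by rewrite !mul0r normr0.
    rewrite (_ : cut y = 1) ?mul1r; last exact: bump_eq1.
    (* Where [a] is nonzero the point lies in the layer, so [kd] applies. *)
    have [->|an0] := eqVneq a 0; first by rewrite !mulr0 normr0 oppr0 mulr0.
    rewrite normrM (ler0_norm a0) ler_wpM2r ?oppr_ge0//.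
    rewrite normrM mulrC ler_pM//; last exact: phiM.
    apply: kd => //; rewrite ltNge; apply/negP => dr'.
    move: an0; rewrite /a /dh; have m1 : 1 <= m * `|rho y|.
      rewrite mulrC -ler_pdivrMr// (le_trans _ dr')// div1r.
      by rewrite -[leRHS]invrK lef_pV2 ?posrE ?invr_gt0.
    have [ry|ry] := leP 0 (rho y).
      by rewrite dstep_le0 ?mulr0 ?eqxx// mulNr oppr_le0 mulr_ge0// ltW.
    by rewrite dstep_ge1 ?mulr0 ?eqxx// mulNr -mulrN -(ltr0_norm ry).
rewrite RintegralZl// (le_trans (ler_norm _))// normrM normrN !normrM sg1 mulr1.
rewrite (gtr0_norm eps0) (ger0_norm M0) normfV (gtr0_norm c0) -mulrA.
apply: ler_wpM2l; first exact: ltW.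
by apply: ler_wpM2l; [rewrite divr_ge0// ltW|exact: integral_dh].
Unshelve. all: by end_near. Qed.

End regular_boundary_point.

End tangential.

(** * The divergence theorem for tangent fields *)

Section divergence_theorem.
Context {R : realType} {d : nat}.
Variables (Omega U : set 'rV[R]_d) (W : 'I_d -> 'rV[R]_d -> R).
Hypotheses (oOmega : open Omega) (bOmega : bounded_set Omega).
Hypotheses (oU : open U) (OmegaU : closure Omega `<=` U).
Hypothesis CW : forall i, C1 U (W i).
Hypothesis tangential : forall x nu, outward_normal Omega x nu ->
  \sum_j W j x * nu 0 j = 0.
Implicit Types (x y : 'rV[R]_d) (phi psi : 'rV[R]_d -> R).

Local Notation leb := (lebesgue_rV d).
Local Notation flux := (int_div Omega W).

(** A small move along the i-th axis, against the sign of the derivative, makes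
    [rho] negative: points of the zero level are limits of points of the domain. *)
Lemma descent_closure (rho : 'rV[R]_d -> R) V y i : open V -> V y ->
  (forall z, V z -> (Omega z <-> rho z < 0)) -> C1 V rho ->
  rho y = 0 -> 'D_(base i) rho y != 0 -> closure Omega y.
Proof.
move=> oV Vy OV [_ dr _] ry dry A Ay.
have /cvg_ex[l ql] := dr i y Vy.
have lE : l = 'D_(base i) rho y by apply/esym; exact: cvg_lim ql.
have l0 : l != 0 by rewrite lE.
have q0 : \forall h \near (0 : R)^',
    0 < l * (h^-1 * (rho (h *: base i + y) - rho y)).
  have : l * (h^-1 *: (rho (h *: base i + y) - rho y)) @[h --> (0 : R)^'] --> l * l.
    exact: cvgM (cvg_cst _) ql.
  move=> /cvgr_gt; apply; rewrite -expr2 exprn_even_gt0//.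
have cline : h *: base i + y @[h --> (0 : R)] --> y.
  have : h *: base i + y @[h --> (0 : R)] --> (0 : R) *: base i + y.
    by apply: cvgD; [apply: cvgZr_tmp; exact: cvg_id|exact: cvg_cst].
  by rewrite scale0r add0r.
have AV : nbhs y (A `&` V) by apply: filterI => //; exact: open_nbhs_nbhs.
have [e /= e0 He] := cline _ AV.
have /nbhs_ballP[e' /= e'0 He'] := q0.
pose m := Num.min e e' / 2.
have m0 : 0 < m by rewrite divr_gt0// lt_min e0.
have mlt a : Num.min e e' <= a -> m < a.
  move=> ea; rewrite (lt_le_trans _ ea)// /m ltr_pdivrMr// ltr_pMr ?ltr1n//.
  by rewrite lt_min e0.
have [h [hm lh]] : exists h : R, `|h| = m /\ l / h < 0.
  have [l_lt0|l_gt0|/eqP] := ltgtP l 0; last by rewrite (negbTE l0).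
    by exists m; rewrite gtr0_norm// pmulr_llt0 ?invr_gt0.
  by exists (- m); rewrite normrN gtr0_norm// invrN mulrN oppr_lt0 divr_gt0.
have h0 : h != 0 by rewrite -normr_gt0 hm.
have [Az Vz] : (A `&` V) (h *: base i + y).
  by apply: He; rewrite /ball/= sub0r normrN hm mlt// ge_min lexx.
exists (h *: base i + y); split=> //; apply/OV => //.
have : 0 < l * (h^-1 * (rho (h *: base i + y) - rho y)).
  by apply: He' => //; rewrite /ball/= sub0r normrN hm mlt// ge_min lexx orbT.
by rewrite ry subr0 mulrA nmulr_rgt0.
Qed.

Lemma enorm_gt0 x i : x 0 i != 0 -> 0 < enorm x.
Proof.
move=> xi; rewrite sqrtr_gt0 /dotr (bigD1 i)//=.
rewrite ltr_pwDl//; first by rewrite -expr2 exprn_even_gt0.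
by apply: sumr_ge0 => j _; rewrite -expr2 sqr_ge0.
Qed.

Lemma flux_local x : closure Omega x -> ~ singular_boundary Omega x ->
  exists2 e, 0 < e & forall phi, C1 setT phi ->
    (forall y, ~ ball x e y -> phi y = 0) -> flux phi = 0.
Proof.
move=> xO nsx; have [Ox|nOx] := pselect (Omega x).
  have [e e0 eO] := nbhs_cube (open_nbhs_nbhs (conj oOmega Ox)).
  exists (e / 2); first by rewrite divr_gt0.
  move=> phi Cphi phi0; have e2 : 0 < e / 2 by rewrite divr_gt0.
  have e21 : e / 2 < e by rewrite ltr_pdivrMr// ltr_pMr// ltr1n.
  exact: (flux_interior oOmega OmegaU CW e2 e21 eO Cphi phi0).
have bx : boundary Omega x by split=> // /interior_subset.
have [nu [_ [U' [rho [[oU' U'x CU' gx OU'] _]]]]] :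
    exists nu, outward_normal Omega x nu.
  by apply: contrapT => H; apply: nsx.
have /rV0Pn[i] := gx; rewrite mxE => dr0.
pose V := U `&` U'.
have oV : open V by exact: openI.
have VU : V `<=` U by exact: subIsetl.
have Vx : V x by split=> //; exact: OmegaU.
have Crho : C1 V rho by apply: C1S (class_C1 CU'); exact: subIsetr.
have OV y : V y -> (Omega y <-> rho y < 0).
  move=> [_ U'y]; have := congr1 (fun A : set _ => A y) OU'.
  rewrite /setI /mkset => E; split=> H.
    by have : (Omega y /\ U' y) by []; rewrite E => -[].
  by have : (rho y < 0 /\ U' y) by []; rewrite -E => -[].
pose s := Num.sg ('D_(base i) rho x); pose c := `|'D_(base i) rho x| / 2.
have c0 : 0 < c by rewrite divr_gt0// normr_gt0.
have [e e0 eP] : exists2 e, 0 < e & cbox (lo x e) (hi x e) `<=`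
    (V `&` [set y | c < s * 'D_(base i) rho y]).
  apply: nbhs_cube; apply: filterI; first exact: open_nbhs_nbhs.
  have [_ _ cdr] := Crho.
  have : s * 'D_(base i) rho y @[y --> x] --> s * 'D_(base i) rho x.
    exact: cvgM (cvg_cst _) (cdr i x Vx).
  move=> /cvgr_gt; apply; rewrite /s -normrEsg /c ltr_pdivrMr//.
  by rewrite ltr_pMr ?normr_gt0// ltr1n.
exists (e / 4); first by rewrite divr_gt0.
move=> phi Cphi phi0.
apply: (flux_regular oOmega CW e0 oV VU _ Crho OV (sg := s) _ c0 (i0 := i)) => //.
- by move=> y /eP[].
- by rewrite normr_sg dr0.
- by move=> y /eP[_ /= /ltW].
- move=> y /eP[Vy /= sy] ry.
  have dry : 'D_(base i) rho y != 0.
    by apply: contraTneq sy => ->; rewrite mulr0 -leNgt ltW.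
  have gy : grad rho y 0 i != 0 by rewrite mxE.
  have bry : boundary Omega y.
    split; first exact: (descent_closure oV Vy OV Crho ry dry).
    by move=> /interior_subset /(OV _ Vy); rewrite ry ltxx.
  have ony : outward_normal Omega y ((enorm (grad rho y))^-1 *: grad rho y).
    split=> //; exists U', rho; split=> //; split=> //; first by case: Vy.
    by apply/rV0Pn; exists i.
  have := tangential ony.
  rewrite (eq_bigr (fun j => (enorm (grad rho y))^-1 *
    (W j y * 'D_(base j) rho y))); last by move=> j _; rewrite !mxE mulrCA.
  rewrite -mulr_sumr => /eqP; rewrite mulf_eq0 invr_eq0.
  by rewrite gt_eqF ?(enorm_gt0 gy)//= => /eqP.
exact: phi0.
Qed.

Lemma C1_onem_bump x e : C1 setT (fun y => 1 - bump x e y).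
Proof. exact: (C1B openT (C1_cst _ _) (C1_bump x e)). Qed.

Lemma onem_bump_ge0_le1 x e y : 0 <= 1 - bump x e y <= 1.
Proof. by have /andP[b0 b1] := bump_ge0_le1 x e y; rewrite subr_ge0 b1/= gerBl. Qed.

(** Removing from [psi] its product with a bump changes the flux by the flux of a
    function supported where the flux is known to vanish. Iterating this plays the
    part of a partition of unity. *)
Lemma flux_cut (s : seq 'rV[R]_d) (rad : 'rV[R]_d -> R) psi : C1 setT psi ->
  (forall x, x \in s -> 0 < rad x /\ forall phi, C1 setT phi ->
    (forall y, ~ ball x (2 * rad x) y -> phi y = 0) -> flux phi = 0) ->
  flux (fun y => psi y * \prod_(x <- s) (1 - bump x (rad x) y)) = flux psi.
Proof.
elim: s psi => [|x s IH] psi Cpsi sP.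
  by congr flux; apply/funext => y; rewrite big_nil mulr1.
have [r0 xP] := sP x (mem_head _ _).
have Cb := C1_onem_bump x (rad x).
rewrite (_ : (fun y => _) = fun y => (psi y * (1 - bump x (rad x) y)) *
    \prod_(x <- s) (1 - bump x (rad x) y)); last first.
  by apply/funext => y; rewrite big_cons mulrA.
rewrite IH; first last.
- by move=> z zs; apply: sP; rewrite inE zs orbT.
- exact: (C1M openT Cpsi Cb).
have Cpb := C1M openT Cpsi (C1_bump x (rad x)).
rewrite (_ : (fun y => _) = fun y => psi y - psi y * bump x (rad x) y); last first.
  by apply/funext => y; rewrite mulrBr mulr1.
rewrite (fluxB oOmega bOmega OmegaU CW Cpsi Cpb) [X in _ - X]xP ?subr0//.
by move=> y xy; rewrite bump_eq0 ?mulr0.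
Qed.

Lemma flux_vanish phi : (forall y, Omega y -> phi y = 0) -> flux phi = 0.
Proof.
move=> phi0; rewrite /int_div (@eq_Rintegral _ _ _ _ _ (fun=> 0)); last first.
  by move=> y /set_mem Oy; rewrite (divM_eq0 W oOmega Oy).
by rewrite Rintegral_cst ?mul0r//; exact: open_measurable_rV.
Qed.

Lemma derive_bump_supp c (e : R) i y : 0 < e -> ~ ball c (3 * e) y ->
  'D_(base i) (bump c e) y = 0.
Proof.
move=> e0 cy.
have e23 : 2 * e < 3 * e by rewrite ltr_pM2r// ltr_nat.
have [V [oV Vy V0]] := vanish_open e23 (fun y => @bump_eq0 R d c e y e0) cy.
rewrite (@near_eq_derive _ _ _ _ (cst 0)) ?derive_cst//.
have Vny : nbhs y V by exact: open_nbhs_nbhs.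
exact: filterS V0 Vny.
Qed.

Lemma W_bounded : exists2 K, 0 <= K & forall i x, Omega x ->
  `|W i x| <= K /\ `|'D_(base i) (W i) x| <= K.
Proof.
have bnd (f : 'rV[R]_d -> R) : (forall x, U x -> {for x, continuous f}) ->
    exists M, forall x, Omega x -> `|f x| <= M.
  move=> cf; have [M _ fM] := continuous_compact_bounded
    (compact_closure_bounded bOmega) (fun x Ox => cf x (OmegaU Ox)).
  by exists M => x /subset_closure; exact: fM.
have /choice[M1 M1P] : forall i, exists M, forall x, Omega x -> `|W i x| <= M.
  by move=> i; apply: bnd; have [] := CW i.
have /choice[M2 M2P] : forall i, exists M, forall x, Omega x ->
    `|'D_(base i) (W i) x| <= M.
  by move=> i; apply: bnd => x Ux; have [_ _ cdW] := CW i; exact: cdW.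
exists (\sum_i (`|M1 i| + `|M2 i|)); first by apply: sumr_ge0 => i _; rewrite addr_ge0.
move=> i x Ox; rewrite (bigD1 i)//=.
have S0 : 0 <= \sum_(j | j != i) (`|M1 j| + `|M2 j|).
  by apply: sumr_ge0 => j _; rewrite addr_ge0.
split.
  rewrite (le_trans (M1P i x Ox))// (le_trans (ler_norm _))// -addrA lerDl.
  by rewrite addr_ge0.
rewrite (le_trans (M2P i x Ox))// (le_trans (ler_norm _))// addrAC lerDr.
by rewrite addr_ge0.
Qed.

Lemma finite_Omega : (leb Omega < +oo)%E.
Proof. by apply: finite_bounded => //; exact: open_measurable_rV. Qed.

(** The cutoff around the k-th cube has a gradient of order 1/r_k on a set of volume
    of order r_k^d. *)
Lemma flux_cubes : exists2 C, 0 <= C & forall (N : nat)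
  (c : nat -> 'rV[R]_d) (r : nat -> R), (forall k, 0 < r k <= 1) -> (0 < d)%N ->
  `|flux (fun y => 1 - \prod_(k <- index_iota 0 N) (1 - bump (c k) (r k) y))| <=
  C * \sum_(0 <= k < N) r k ^+ d.-1.
Proof.
have [K K0 KP] := W_bounded.
(* [K] bounds the field and its derivatives; the bump and its derivative are at
   most 1 + 4 / r <= 5 / r, and vanish outside a cube of side 6 r. *)
exists (K * d%:R * 5 * 6 ^+ d); first by rewrite !mulr_ge0// exprn_ge0.
move=> N c r r01 d0.
have mO := open_measurable_rV oOmega.
pose s := index_iota 0 N; pose b k y := 1 - bump (c k) (r k) y.
pose eta y := \prod_(k <- s) b k y.
have Ceta : C1 setT eta by apply: C1_prod => k; exact: C1_onem_bump.
have C1eta : C1 setT (fun y => 1 - eta y) by exact: (C1B openT (C1_cst _ _) Ceta).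
pose a k : R := K * d%:R * 5 / r k.
have a0 k : 0 <= a k.
  by have /andP[r0 _] := r01 k; rewrite !mulr_ge0// invr_ge0 ltW.
pose B k : set 'rV[R]_d := ball (c k) (3 * r k).
have mB k : measurable (B k) by apply: open_measurable_rV; exact: ball_open.
have intB k : leb.-integrable Omega (EFin \o ((cst (a k)) \_ (B k))).
  rewrite -restrict_EFin.
  apply: (@integrable_restrict _ _ _ leb (B k) (mB k) Omega mO (EFin \o cst (a k))).1.
  apply: measurable_bounded_integrable.
  - exact: measurableI.
  - rewrite (le_lt_trans _ finite_Omega)//; apply: le_measure; rewrite ?inE//.
    exact: measurableI.
  - exact: measurable_cst.
  - exact: bounded_cst.
have [intS intSE] := Rintegral_sum s mO intB.
rewrite (le_trans (le_normr_Rintegral mO (divM_integrable oOmega bOmega OmegaU CW C1eta)))//.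
apply: (@le_trans _ _ (\int[leb]_(y in Omega) (\sum_(k <- s) (cst (a k) \_ (B k)) y))).
  apply: le_Rintegral => //.
    by have := integrable_norm (divM_integrable oOmega bOmega OmegaU CW C1eta).
  move=> y Oy.
  have e01 k : 0 <= b k y <= 1 by exact: onem_bump_ge0_le1.
  have /andP[eta0 eta1] : 0 <= eta y <= 1 by exact: prod_ge0_le1.
  pose t k := cst (5 / r k) \_ (B k) y.
  have tP i k : `|'D_(base i) (b k) y| + (1 - b k y) <= t k.
    have /andP[r0 r1] := r01 k.
    rewrite /b (deriveB_C1 i (C1_cst setT 1) (C1_bump _ _))// derive_cst sub0r.
    rewrite normrN subKr.
    rewrite /t patchE; case: ifPn => [/set_mem By|/negP By].
      have := derive_bump_le (c k) i y r0.
      have /andP[b0 b1] := bump_ge0_le1 (c k) (r k) y.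
      have r1' : 1 <= (r k)^-1 by rewrite invf_ge1.
      rewrite /cst; lra.
    have nBy : ~ ball (c k) (3 * r k) y by move=> h; apply: By; rewrite inE.
    rewrite derive_bump_supp// normr0 add0r bump_eq0// => h; apply: nBy.
    by apply: le_ball h; rewrite ler_pM2r// ler_nat.
  have fP i : `|'D_(base i) (fun y => 1 - eta y) y| + `|1 - eta y| <=
      \sum_(k <- s) t k.
    rewrite (deriveB_C1 i (C1_cst setT 1) Ceta)// derive_cst sub0r normrN.
    rewrite (@ger0_norm _ (1 - eta y)) ?subr_ge0//.
    apply: (@le_trans _ _ (\sum_(k <- s) (`|'D_(base i) (b k) y| + (1 - b k y)))).
      rewrite big_split/= lerD//; last by have := onem_prod_le s e01.
      exact: (derive_prod_le s i (fun k => C1_onem_bump (c k) (r k)) e01).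
    by apply: ler_sum => k _; exact: tP.
  apply: (@le_trans _ _ (\sum_(i < d) K * \sum_(k <- s) t k)).
    rewrite (le_trans (ler_norm_sum _ _ _))// ler_sum// => i _.
    have [W1 W2] := KP i y Oy.
    rewrite (le_trans (ler_normD _ _))// (le_trans _ (ler_wpM2l K0 (fP i)))//.
    rewrite !normrM mulrDr lerD//; first by rewrite mulrC ler_wpM2r.
    by rewrite mulrC ler_wpM2r.
  rewrite sumr_const card_ord -mulr_natl mulrA mulr_sumr ler_sum// => k _.
  rewrite /t !patchE; case: ifPn => // _; last by rewrite mulr0.
  by rewrite /cst /a le_eqVlt; apply/orP; left; apply/eqP; ring.
rewrite intSE mulr_sumr ler_sum// => k _.
have /andP[r0 r1] := r01 k.
rewrite -Rintegral_mkcondr Rintegral_cst; last exact: measurableI.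
rewrite (_ : _ * r k ^+ d.-1 = a k * (6 * r k) ^+ d); last first.
  rewrite /a exprMn -[in RHS](prednK d0) [r k ^+ _.+1]exprS prednK//.
  by field; rewrite gt_eqF.
rewrite ler_wpM2l//.
have v : leb (B k) = ((6 * r k) ^+ d)%:E.
  rewrite /B ball_cube ?mulr_gt0// lebesgue_box; last first.
    by move=> i; rewrite !mxE lerD2l ge0_cp// mulr_ge0// ltW.
  congr EFin; rewrite (eq_bigr (fun=> 6 * r k)).
    by rewrite prodr_const card_ord.
  by move=> i _; rewrite !mxE; ring.
rewrite -lee_fin -v fineK.
  by apply: le_measure; rewrite ?inE//; exact: measurableI.
rewrite ge0_fin_numE// (le_lt_trans _ finite_Omega)//.
by apply: le_measure; rewrite ?inE//; exact: measurableI.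
Qed.

Hypothesis nullS : hypersurface_null (singular_boundary Omega).

(** The closure of the domain is compact, so finitely many cubes suffice: cubes from
    a cover of the singular set, and cubes centred at the other points on which
    the flux vanishes locally. The product of all the functions 1 - bump is 0 on the
    domain, and by [flux_cut] the factors of the second kind do not change the
    flux of [eta], the product of those of the first kind. *)
Lemma flux1_le (e : R) : 0 < e <= 1 -> exists (N : nat)
    (c : nat -> 'rV[R]_d) (r : nat -> R),
  [/\ forall k : nat, 0 < r k <= 1, (0 < d)%N,
      \sum_(0 <= k < N) r k ^+ d.-1 <= e &
      flux (fun=> 1) =
      flux (fun y => 1 - \prod_(k <- index_iota 0 N) (1 - bump (c k) (r k) y))].
Proof.
move=> /andP[e0 e1]; have [c [r [r0 Sc rsum]]] := nullS e0.
have psum N : \sum_(0 <= k < N) r k ^+ d.-1 < e.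
  rewrite -lte_fin (le_lt_trans _ rsum)// -sumEFin; apply: nneseries_lim_ge.
  by move=> k _; rewrite lee_fin exprn_ge0// ltW.
have rd k : r k ^+ d.-1 < 1.
  rewrite (lt_le_trans _ e1)// (le_lt_trans _ (psum k.+1))//.
  rewrite big_nat_recr//= lerDr sumr_ge0// => j _.
  by rewrite exprn_ge0// ltW.
have d0 : (0 < d)%N.
  by case: d rd => // /(_ 0%N); rewrite expr0 ltxx.
have r1 k : 0 < r k <= 1.
  rewrite r0/= leNgt; apply/negP => rk.
  by have := rd k; rewrite ltNge exprn_ege1// ltW.
have /choice[rad radP] : forall x, exists rx : R,
    closure Omega x -> ~ singular_boundary Omega x ->
    0 < rx /\ forall phi, C1 setT phi ->
      (forall y, ~ ball x (2 * rx) y -> phi y = 0) -> flux phi = 0.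
  move=> x; have [xO|xO] := pselect (closure Omega x); last by exists 0.
  have [xs|xs] := pselect (singular_boundary Omega x); first by exists 0.
  have [rx rx0 xP] := flux_local xO xs.
  exists (rx / 2) => _ _; split; first by rewrite divr_gt0.
  move=> phi Cphi phi0; apply: xP => // y.
  by rewrite (_ : rx = 2 * (rx / 2)); [exact: phi0|field].
pose good : set 'rV[R]_d := [set x | closure Omega x /\ ~ singular_boundary Omega x].
pose I : choiceType := ('rV[R]_d + nat)%type.
pose D : set I := [set i | match i with inl x => good x | inr _ => True end].
pose f (i : I) : set 'rV[R]_d :=
  match i with inl x => ball x (rad x) | inr k => ball (c k) (r k) end.
have : cover_compact (closure Omega).
  by rewrite -compact_cover; exact: compact_closure_bounded.
move=> /(_ I D f) [].
- by move=> [x|k] _; exact: ball_open.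
- move=> x xO; have [xs|xs] := pselect (singular_boundary Omega x).
    by have [k _ xk] := Sc _ xs; exists (inr k).
  exists (inl x) => //; apply: ballxx.
  by have [] := radP x xO xs.
move=> D' D'D cov.
pose s : seq 'rV[R]_d :=
  pmap (fun i : I => match i with inl x => Some x | inr _ => None end)
    (finmap.enum_fset D').
pose idx (i : I) := match i with inl _ => 0%N | inr k => k end.
pose N := (\max_(i <- finmap.enum_fset D') idx i).+1.
exists N, c, r; split=> //; first exact: ltW.
have sP x : x \in s -> 0 < rad x /\ forall phi, C1 setT phi ->
    (forall y, ~ ball x (2 * rad x) y -> phi y = 0) -> flux phi = 0.
  rewrite mem_pmap => /mapP[[z|k]// zD [->]].
  by have := D'D _ zD; rewrite inE => -[h1 h2]; exact: radP.
pose eta y := \prod_(k <- index_iota 0 N) (1 - bump (c k) (r k) y).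
have Ceta : C1 setT eta by apply: C1_prod => k; exact: C1_onem_bump.
rewrite (fluxB oOmega bOmega OmegaU CW (C1_cst _ _) Ceta).
suff -> : flux eta = 0 by rewrite subr0.
rewrite -(flux_cut Ceta sP); apply: flux_vanish => y Oy.
have [[x|k] iD' yi] := cov y (subset_closure Oy).
  have xs : x \in s by rewrite mem_pmap; apply/mapP; exists (inl x).
  have [rx0 _] := sP x xs.
  rewrite [X in _ * X](big_rem x xs)/= bump_eq1//.
  by rewrite subrr mul0r mulr0.
have kN : k \in index_iota 0 N.
  rewrite mem_index_iota /N ltnS/=.
  exact: (@leq_bigmax_seq _ _ _ idx (inr k)).
by rewrite /eta (big_rem k kN)/= bump_eq1 ?subrr ?mul0r//; case/andP: (r1 k).
Qed.

(** The singular set is null in dimension d-1, so the right-hand side of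
    [flux_cubes] can be made arbitrarily small. *)
Lemma divergence_tangential :
  \int[leb]_(x in Omega) (\sum_i 'D_(base i) (W i) x) = 0.
Proof.
have -> : \int[leb]_(x in Omega) (\sum_i 'D_(base i) (W i) x) = flux (fun=> 1).
  apply: eq_Rintegral => x _; apply: eq_bigr => i _.
  by rewrite derive_cst mul0r add0r mul1r.
have [C C0 CP] := flux_cubes.
suff H e : 0 < e <= 1 -> `|flux (fun=> 1)| <= C * e.
  apply/eqP; rewrite -normr_le0; apply/ler_addgt0Pr => e e0; rewrite add0r.
  pose e' := Num.min 1 (e / (C + 1)).
  have C1 : 0 < C + 1 by rewrite ltr_wpDl.
  have e'0 : 0 < e' by rewrite lt_min ltr01 divr_gt0.
  rewrite (le_trans (H e' _))//; first by rewrite e'0 ge_min lexx.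
  rewrite (@le_trans _ _ (C * (e / (C + 1))))//.
    by rewrite ler_wpM2l// ge_min lexx orbT.
  by rewrite mulrA ler_pdivrMr// mulrC ler_pM2l// lerDl.
move=> e01; have [N [c [r [r01 d0 rs ->]]]] := flux1_le e01.
rewrite (le_trans (CP N c r r01 d0))// ler_wpM2l//.
Qed.

End divergence_theorem.

(** * Green's identity and the energy law *)

Section green.
Context {R : realType} {d : nat}.
Implicit Types (Omega U : set 'rV[R]_d) (f : 'rV[R]_d -> R).

Local Notation leb := (lebesgue_rV d).

Lemma bounded_box (a b : 'rV[R]_d) : bounded_set (box a b).
Proof.
have [M [Mr bM]] := compact_bounded (@compact_cbox R d a b).
by exists M; split=> // N MN x /box_cbox; exact: bM.
Qed.

Lemma derive_periodic f (p v : 'rV[R]_d) x : (forall y, f (y + p) = f y) ->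
  'D_v f (x + p) = 'D_v f x.
Proof.
move=> fp; rewrite /derive; set g1 := fun h => h^-1 *: _.
set g2 := fun h => h^-1 *: _; suff -> : g1 = g2 by [].
by apply/funext => h; rewrite /g1 /g2 /= addrA !fp.
Qed.

Lemma integral_div_periodic (a b : 'rV[R]_d) (W : 'I_d -> 'rV[R]_d -> R) :
  (forall i, a 0 i < b 0 i) -> (forall i, C1 setT (W i)) ->
  (forall i x, W i (x + (b 0 i - a 0 i) *: base i) = W i x) ->
  \int[leb]_(x in box a b) (\sum_i 'D_(base i) (W i) x) = 0.
Proof.
move=> ab CW Wp; rewrite (Rintegral_sum _ (measurable_box a b) _).2.
  rewrite big1// => i _; have [cW dW cdW] := CW i.
  rewrite /Rintegral (@integral_derive_box _ _ _ _ setT _ i ab openT _ cW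
    (dW i) (cdW i))// => x _ _; exact: Wp.
by move=> i; apply: continuous_box_integrable => x _; have [_ _] := CW i; exact.
Qed.

(** div (u grad u) = |grad u|^2 + u Lap u. *)
Lemma green_of_div Omega U (u : 'rV[R]_d -> R) :
  open Omega -> bounded_set Omega -> open U -> closure Omega `<=` U ->
  class_C 2 U u ->
  \int[leb]_(x in Omega)
    (\sum_i 'D_(base i) (fun y => u y * 'D_(base i) u y) x) = 0 ->
  leb.-integrable Omega (EFin \o (fun x => u x * laplacian u x)) /\
  \int[leb]_(x in Omega) (u x * laplacian u x) =
  - \int[leb]_(x in Omega) dotr (grad u x) (grad u x).
Proof.
move=> oO bO oU OU C2u; have Cu := class_C1 C2u; have CDu i := class_C2 i C2u.
have int1 : leb.-integrable Omega (EFin \o (fun x => u x * laplacian u x)).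
  apply: continuous_closure_integrable => // x /OU Ux.
  apply: continuousM_at; first by have [cu _ _] := Cu; exact: cu.
  by apply: continuous_sum_rV => i; have [_ _ cdd] := CDu i; exact: cdd.
have int2 : leb.-integrable Omega (EFin \o (fun x => dotr (grad u x) (grad u x))).
  apply: continuous_closure_integrable => // x /OU Ux.
  rewrite (_ : (fun x => _) = fun x => \sum_i 'D_(base i) u x * 'D_(base i) u x).
    apply: continuous_sum_rV => i; have [cd _ _] := CDu i.
    by apply: continuousM_at; exact: cd.
  by apply/funext => y; apply: eq_bigr => i _; rewrite !mxE.
move=> div0; split=> //; apply/eqP; rewrite -addr_eq0 -RintegralD//; last first.
  exact: open_measurable_rV.
rewrite -div0; apply/eqP; apply: eq_Rintegral => x /set_mem/subset_closure/OU Ux.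
rewrite /laplacian /dotr mulr_sumr -big_split/=; apply: eq_bigr => i _.
by rewrite (deriveM_C1 i Cu (CDu i) Ux) !mxE addrC.
Qed.

(** The field u grad u is periodic in the first case, and tangent to the regular
    part of the boundary in the second, since there the normal derivative of [u]
    is 0. *)
Lemma green_identity (bc : boundary_condition R d) Omega (u : 'rV[R]_d -> R) :
  is_domain bc Omega -> admissible bc Omega u ->
  leb.-integrable Omega (EFin \o (fun x => u x * laplacian u x)) /\
  \int[leb]_(x in Omega) (u x * laplacian u x) =
  - \int[leb]_(x in Omega) dotr (grad u x) (grad u x).
Proof.
case: bc => [a b [ab ->] [C2u up]|].
  rewrite -/(box a b); apply: (green_of_div (U := setT)) => //.
  - exact: open_box.
  - exact: bounded_box.
  - exact: openT.
  apply: integral_div_periodic => // i.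
    exact: (C1M openT (class_C1 C2u) (class_C2 i C2u)).
  by move=> x; rewrite up (derive_periodic (p := _ *: base i)).
move=> [oO _ _ bO nullS] [[U [oU OU C2u]] nu0].
apply: (green_of_div oO bO oU OU C2u).
apply: (divergence_tangential oO bO oU OU) => //.
  by move=> i; exact: (C1M oU (class_C1 C2u) (class_C2 i C2u)).
move=> x nu xnu; transitivity (u x * dotr (grad u x) nu).
  by rewrite /dotr mulr_sumr; apply: eq_bigr => i _; rewrite mxE mulrA.
by rewrite (nu0 _ _ xnu) mulr0.
Qed.

End green.

Unset Implicit Arguments.

Theorem theorem2p3 (R : realType) (d : nat) (hd : d = 2%N \/ d = 3%N)
  (bc : boundary_condition R d) (Omega : set 'rV[R]_d)
  (hOmega : is_domain bc Omega)
  (eps : R) (heps : 0 < eps) (F : R -> R) (hF : smooth F) (C0 : R)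
  (hC0 : forall f, admissible bc Omega f ->
           0 < shifted_energy Omega eps F C0 f)
  (dt : R) (hdt : 0 < dt) (lambda : R) (hlambda : 0 < lambda)
  (phi mu phibar : nat -> 'rV[R]_d -> R) (r : nat -> R)
  (k : nat) (hk : k = 3%N \/ k = 4%N) (n : nat) (hn : (k - 1 <= n)%N)
  (hstep : RAV_BDF_step bc Omega eps F C0 dt lambda phi mu phibar r k n) :
  bdf_alpha k * (energy Omega eps F (phi n.+1) + r n.+1)
  - bdf_A k (fun m => energy Omega eps F (phi m) + r m) n <= 0.
Proof.
case: hstep => _ _ mu_adm phi_eq _ r_eq _.
have [int_lap green] := green_identity hOmega mu_adm.
have mO : measurable Omega.
  apply: open_measurable_rV; case: {mu_adm hC0} bc hOmega => [a b [_ ->]|[]//].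
  exact: open_box.
(* [r n.+1] is the minimum of 0 and [rav_U]. *)
have r_le : r n.+1 <= rav_U Omega eps F dt phi mu r k n.
  by rewrite r_eq; case: ifP.
have dt0 : dt != 0 by rewrite gt_eqF.
case: hk phi_eq r_le => -> phi_eq; rewrite /rav_U /bdf_alpha /bdf_A.
- rewrite (@eq_Rintegral _ _ _ _ _ (fun x =>
      6 / 11 * dt * (mu n.+1 x * laplacian (mu n.+1) x))); last first.
    move=> x /set_mem Ox; rewrite -phi_eq//= /bdf_alpha /bdf_A; field.
    by rewrite dt0.
  rewrite RintegralZl// green; lra.
- rewrite (@eq_Rintegral _ _ _ _ _ (fun x =>
      12 / 25 * dt * (mu n.+1 x * laplacian (mu n.+1) x))); last first.
    move=> x /set_mem Ox; rewrite -phi_eq//= /bdf_alpha /bdf_A; field.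
    by rewrite dt0.
  rewrite RintegralZl// green; lra.
Qed.
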